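(* Let $1<\alpha<2$, $n\ge 2$, and consider the fractional-order system $\frac{d^{\alpha}x}{dt^{\alpha}}=g(x,\mu)$ with equilibrium $x^*$, Jacobian matrix $J(\mu)$ at $x^*$, and characteristic polynomial $f(\lambda;\alpha,\mu)=\lambda^n+a_1\lambda^{n-1}+\cdots+a_n$, $a_i=a_i(\alpha,\mu)$ real and continuous in $\mu$. Suppose there exists a parameter value $\mu^*$ such that 1. (eigenvalues condition) $\nabla_n(\mu^* )=0$, $\nabla_p(\mu^* )>0$ for $p=1,2,\dots,n-1$, and $\widetilde{\nabla}(\mu^* )<0$; 2. (transversality condition) $\nabla_n(\mu)$ is indefinite in any neighborhood of $\mu^*$, i.e. for every neighborhood $\delta(\mu^* )$ of $\mu^*$ there exist $\mu_1,\mu_2\in\delta(\mu^* )$ with $\nabla_n(\mu_1)>0$ and $\nabla_n(\mu_2)<0$. Then the system undergoes a Hopf bifurcation at $\mu^*$.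
   Context: System: $\alpha\in(1,2)$ is the order of the (Caputo) fractional derivative, $x=(x_1,\dots,x_n)^T$ is the state, $\mu=(\mu_1,\dots,\mu_m)$ is a vector of real bifurcation parameters ranging over an open subset of $\mathbb{R}^m$, and $g=(g_1,\dots,g_n)^T$ is nonlinear. $x^*$ is an equilibrium point, $J(\mu)$ is the Jacobian matrix of the system at $x^*$, and $f(\lambda;\alpha,\mu)$ is its monic real characteristic polynomial, with coefficients $a_j=a_j(\alpha,\mu)$ and $a_0=1$. Regions: $\Omega=\{z\in\mathbb{C}: |\arg z|>\frac{\alpha\pi}{2}\}$ (stable region), $\Sigma=\{z\in\mathbb{C}: |\arg z|<\frac{\alpha\pi}{2}\}$ (unstable region), $\Gamma=\{z\in\mathbb{C}: |\arg z|=\frac{\alpha\pi}{2}\}$ (critical line), where $z\ne 0$ and $\arg z\in(-\pi,\pi]$. Hopf bifurcation: the system undergoes a Hopf bifurcation at $\mu^*$ if $f(\lambda;\alpha,\mu)$ has a pair of conjugate complex roots which cross $\Gamma$ from $\Omega$ to $\Sigma$ as the parameter $\mu$ changes through $\mu^*$, while the other roots are all in $\Omega$. Precisely: there are a neighborhood $U_0$ of $\mu^*$ and a continuous function $\lambda:U_0\to\mathbb{C}\setminus\mathbb{R}$ such that, for $\mu\in U_0$, $\lambda(\mu)$ and $\overline{\lambda(\mu)}$ are roots of $f(\cdot;\alpha,\mu)$ and the remaining $n-2$ roots (counted with multiplicity) lie in $\Omega$; $\lambda(\mu^* )\in\Gamma$; and every neighborhood of $\mu^*$ contains points $\mu$ of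 $U_0$ with $\lambda(\mu)\in\Omega$ and points $\mu$ of $U_0$ with $\lambda(\mu)\in\Sigma$. Matrix $H_\alpha$: for $j=0,1,\dots,n$ put $\overline{a}_j=a_j\sin\left(\frac{(n-j)\alpha\pi}{2}\right)$ and $\overline{b}_j=a_j\cos\left(\frac{(n-j)\alpha\pi}{2}\right)$ (real numbers, the bar is just notation; $\overline{a}_n=0$), and $\overline{a}_j=\overline{b}_j=0$ for $j<0$ or $j>n$. These are the coefficients of $r^{n-j}$ in the imaginary and real parts of $f(re^{i\alpha\pi/2};\alpha,\mu)$ for real $r$. The fractional-order Routh-Hurwitz matrix $H_\alpha(\mu)$ is the $2n\times 2n$ matrix whose row $2k-1$ has $\overline{a}_{j-k}$ in column $j$ and whose row $2k$ has $\overline{b}_{j-k}$ in column $j$, for $k=1,\dots,n$ and $j=1,\dots,2n$. $\nabla_p(\mu)$ ($p=1,\dots,n$) is the leading principal minor of $H_\alpha(\mu)$ of order $2p$. $\widetilde{\nabla}(\mu)$ is the determinant of the $2(n-1)\times2(n-1)$ matrix formed from the first $2n-2$ rows of $H_\alpha(\mu)$ and its columns $1,2,\dots,2n-3$ and $2n-1$ (in this order). *)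

(* Defs.v *)
From mathcomp Require Import all_boot all_order all_algebra.
From mathcomp Require Import all_classical all_reals all_analysis.
From mathcomp Require Export complex.
Set Implicit Arguments.
Unset Strict Implicit.
Unset Printing Implicit Defensive.
Import Order.TTheory GRing.Theory Num.Theory.
Import numFieldNormedType.Exports.

Local Open Scope classical_set_scope.
Local Open Scope ring_scope.

Section ComplexPlane.
Variable R : realType.
Implicit Types (z : R[i]) (alpha : R).

(* Principal argument, in ]-pi, pi]; meaningless at 0. *)
Definition arg z : R :=
  let t := acos (complex.Re z / Normc.normc z) in
  if 0 <= complex.Im z then t else - t.

Lemma argP z : z != 0 ->
  - pi < arg z <= pi /\
  z = Complex (Normc.normc z * cos (arg z)) (Normc.normc z * sin (arg z)).
Proof.
case: z => x y z0; rewrite /arg /=.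
set r := Num.sqrt _.
have s_ge0 : 0 <= x ^+ 2 + y ^+ 2 by rewrite addr_ge0 ?sqr_ge0.
have r2 : r ^+ 2 = x ^+ 2 + y ^+ 2 by rewrite sqr_sqrtr.
have r_gt0 : 0 < r.
  rewrite sqrtr_gt0 lt_neqAle s_ge0 andbT eq_sym paddr_eq0 ?sqr_ge0 //.
  by rewrite !sqrf_eq0; apply: contra z0 => /andP[/eqP-> /eqP->].
have r_neq0 : r != 0 by rewrite gt_eqF.
have xr : -1 <= x / r <= 1.
  rewrite -ler_norml normrM normfV (gtr0_norm r_gt0) ler_pdivrMr // mul1r.
  rewrite -(ler_pXn2r (n := 2)) ?nnegrE ?normr_ge0 ?sqrtr_ge0 //.
  rewrite real_normK ?num_real //.
  by rewrite r2 lerDl sqr_ge0.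
have y2 : Num.sqrt (1 - (x / r) ^+ 2) = `|y| / r.
  have -> : 1 - (x / r) ^+ 2 = (y / r) ^+ 2.
    apply: (mulIf (expf_neq0 2 r_neq0)).
    by rewrite mulrBl -!exprMn !divfK // mul1r r2 addrC addKr.
  by rewrite sqrtr_sqr normrM normfV (gtr0_norm r_gt0).
have rK t : r * (t / r) = t by rewrite mulrC divfK.
have pi0 := pi_gt0 R.
case: (leP 0 y) => y0.
  split.
    by rewrite acos_lepi // andbT (lt_le_trans _ (acos_ge0 _)) // oppr_lt0.
  by rewrite acosK ?in_itv //= sin_acos // y2 (ger0_norm y0) !rK.
have xr1 : -1 < x / r.
  case/andP: xr => xr _; rewrite lt_neqAle xr andbT; apply: contraTneq y0 => e.
  move: y2; rewrite -e sqrrN expr1n subrr sqrtr0 => /esym/eqP.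
  by rewrite mulf_eq0 invr_eq0 (negbTE r_neq0) orbF normr_eq0 => /eqP->; rewrite ltxx.
split.
  rewrite ltrN2 acos_ltpi ?xr1 ?(andP xr).2 //=.
  by rewrite (le_trans _ (ltW pi0)) // oppr_le0 acos_ge0.
rewrite cosN sinN acosK ?in_itv //= sin_acos // y2 (ltr0_norm y0).
by rewrite mulNr opprK !rK.
Qed.

Definition stable_region alpha : set R[i] :=
  [set z | z != 0 /\ `|arg z| > alpha * pi / 2].

Definition unstable_region alpha : set R[i] :=
  [set z | z != 0 /\ `|arg z| < alpha * pi / 2].

Definition critical_line alpha : set R[i] :=
  [set z | z != 0 /\ `|arg z| = alpha * pi / 2].

End ComplexPlane.

Section RouthHurwitz.
Variables (R : realType) (n : nat) (alpha : R) (f : {poly R}).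

(* [f] is monic of degree [n], written 'X^n + a_1 'X^(n-1) + ... + a_n. *)
Definition hcoef (j : nat) : R := if (j <= n)%N then f`_(n - j) else 0.

Definition abar (j : nat) : R := hcoef j * sin ((n - j)%:R * alpha * pi / 2).

Definition bbar (j : nat) : R := hcoef j * cos ((n - j)%:R * alpha * pi / 2).

(* Entries of the fractional-order Routh-Hurwitz matrix, numbered from 0 (so
   rows 2k-1 and 2k are numbers 2(k-1) and 2(k-1)+1); [RH_entry i j] is only
   used for i, j < 2n. Its submatrices are written directly in terms of these
   entries, which avoids casts between ordinals. *)
Definition RH_entry (i j : nat) : R :=
  if (j < i./2)%N then 0
  else if odd i then bbar (j - i./2) else abar (j - i./2).

(* Leading principal minor of order 2p. *)
Definition nabla (p : nat) : R :=
  \det (\matrix_(i < 2 * p, j < 2 * p) RH_entry i j).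

(* Rows 1, ..., 2n-2 and columns 1, ..., 2n-3, 2n-1; from 0, the columns are
   0, ..., 2n-4, 2n-2. *)
Definition nabla_tilde : R :=
  \det (\matrix_(i < 2 * n - 2, j < 2 * n - 2)
          RH_entry i (if j == (2 * n - 3)%N :> nat then 2 * n - 2 else j)%N).

End RouthHurwitz.

Section FractionalSystem.
Variables (R : realType) (n m : nat).

(* The system of order alpha with right-hand side [g]. Since the Caputo
   derivative of a constant is 0, equilibria are the zeros of [g]. *)
Definition equilibrium (g : 'rV[R]_n -> 'rV[R]_m -> 'rV[R]_n)
  (mu : 'rV[R]_m) (x : 'rV[R]_n) : Prop := g x mu = 0.

(* [jacobian] acts on row vectors; transposed, its (i, j) entry is the usual
   partial derivative of the i-th component along the j-th coordinate. *)
Definition jacobian_at (g : 'rV[R]_n -> 'rV[R]_m -> 'rV[R]_n)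
    (mu : 'rV[R]_m) (x : 'rV[R]_n) : 'M[R]_n :=
  (jacobian (fun y => g y mu) x)^T.

(* Characteristic polynomial at the equilibria [xs mu], which may move with the
   parameter. *)
Definition sys_charpoly (g : 'rV[R]_n -> 'rV[R]_m -> 'rV[R]_n)
    (xs : 'rV[R]_m -> 'rV[R]_n) (mu : 'rV[R]_m) : {poly R} :=
  char_poly (jacobian_at g mu (xs mu)).

(* [U] is the open set of parameters and [lam] is only relevant on [U0];
   [R[i]^o] carries the topology of the modulus. *)
Definition hopf_bifurcation (alpha : R) (U : set 'rV[R]_m)
    (g : 'rV[R]_n -> 'rV[R]_m -> 'rV[R]_n) (xs : 'rV[R]_m -> 'rV[R]_n)
    (mus : 'rV[R]_m) : Prop :=
  exists (U0 : set 'rV[R]_m) (lam : 'rV[R]_m -> R[i]),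
    [/\ nbhs mus U0 /\ U0 `<=` U,
        {within U0, continuous (lam : 'rV[R]_m -> R[i]^o)},
        forall mu, U0 mu ->
          lam mu \isn't Num.real /\
          exists2 s : (n - 2).-tuple R[i],
            map_poly (real_complex R) (sys_charpoly g xs mu) =
              ('X - (lam mu)%:P) * ('X - (conjc (lam mu))%:P)
                * \prod_(z <- s) ('X - z%:P)
            & forall z, z \in s -> stable_region alpha z,
        critical_line alpha (lam mus) &
        forall V : set 'rV[R]_m, nbhs mus V ->
          (exists2 mu, (V `&` U0) mu & stable_region alpha (lam mu)) /\
          (exists2 mu, (V `&` U0) mu & unstable_region alpha (lam mu))].

End FractionalSystem.

(* Main.v *)
Require Import Defs.
From mathcomp Require Import all_boot all_order all_algebra.
From mathcomp Require Import all_classical all_reals all_analysis.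
From mathcomp Require Import ring lra zify.
Import Order.TTheory GRing.Theory Num.Theory.
Import numFieldNormedType.Exports.
Local Open Scope classical_set_scope.
Local Open Scope ring_scope.
Set Implicit Arguments.
Unset Strict Implicit.
Unset Printing Implicit Defensive.

(** With [w = exp(i alpha pi / 2)], write [w^-n f(w x) = P + i Q] for real [P], [Q] with
    [deg Q < n = deg P]; a root [z] of [f] is a root [x = z / w] of [P + i Q], and [f] is
    stable iff all these [x] lie in the upper half plane. Dividing,
    [P = (c x + d) Q + S], multiplies every minor by the positive factor [nabla_1] and
    replaces [(P, Q)] by [(Q, - S)], so positivity of the minors means [c < 0] at every
    step of the Euclidean algorithm. Since
      [Im (P conj Q) = c Im x |Q|^2 + Im (Q conj (- S))],
    all [nabla_p > 0] forces every root into the upper half plane; if only the last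
    minor vanishes, the algorithm stops at a common factor [x - r], with
    [r = - nabla_tilde / nabla_1] at the last stage, which is positive. If only the last
    minor is negative, the Bezout form of [P, Q] takes a positive value, whereas
    Hermite's formula makes it a sum of the [- Im x |l_x|^2] over the roots [x]: some
    root lies in the lower half plane. Roots depend continuously on the
    parameters, so the pair on the critical line persists as a continuous pair, and
    the sign of [nabla_n] tells on which side it lies. *)

Local Notation toC := (map_poly (real_complex _)).

(** * Interleaved Hurwitz determinants *)

Definition ndet (R : comNzRingType) (N : nat) (e : nat -> nat -> R) : R :=
  \det (\matrix_(i < N, j < N) e i j).

Lemma eq_ndet (R : comNzRingType) N (e e' : nat -> nat -> R) :
  (forall i j, (i < N)%N -> (j < N)%N -> e i j = e' i j) -> ndet N e = ndet N e'.
Proof. by move=> H; congr (\det _); apply/matrixP => i j; rewrite !mxE H. Qed.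

Lemma ndet_expand_col0 (R : comNzRingType) N k (e : nat -> nat -> R) :
  (k <= N)%N -> (forall i, (i <= N)%N -> i != k -> e i 0%N = 0) ->
  ndet N.+1 e = (-1) ^+ k * e k 0%N * ndet N (fun i j => e (bump k i) j.+1).
Proof.
move=> kN e0; rewrite /ndet (expand_det_col _ ord0).
have kN1 : (k < N.+1)%N by [].
rewrite (bigD1 (Ordinal kN1)) //= big1 ?addr0 => [|i ik].
  rewrite mxE /cofactor addn0 mulrCA mulrA; congr (_ * \det _).
  by apply/matrixP => i j; rewrite !mxE.
by rewrite mxE e0 ?mul0r // -ltnS.
Qed.

Lemma ndet_mul (R : comNzRingType) N (l e : nat -> nat -> R) :
  ndet N (fun i j => \sum_(k < N) l i k * e k j) = ndet N l * ndet N e.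
Proof.
rewrite /ndet -det_mulmx; congr (\det _); apply/matrixP => i j; rewrite !mxE.
by apply: eq_bigr => k _; rewrite !mxE.
Qed.

Lemma ndet_unitrig (R : comNzRingType) N (l : nat -> nat -> R) :
  (forall i j, (i < j)%N -> l i j = 0) -> (forall i, l i i = 1) -> ndet N l = 1.
Proof.
move=> l0 l1; rewrite /ndet det_trig.
  by rewrite big1 // => i _; rewrite mxE.
by apply/is_trig_mxP => i j ij; rewrite mxE l0.
Qed.

Lemma sum_double (V : nmodType) p (F : nat -> V) :
  \sum_(k < p.*2) F k = \sum_(k < p) (F k.*2 + F k.*2.+1).
Proof.
elim: p => [|p IH]; first by rewrite !big_ord0.
by rewrite doubleS !big_ord_recr /= IH addrA.
Qed.

Lemma sum_deltaE (R : pzRingType) p k (F : nat -> R) : (k < p)%N ->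
  \sum_(m < p) (if k == m then F m else 0) = F k.
Proof.
by move=> kp; rewrite -big_mkcond (big_pred1 (Ordinal kp)) // => i; rewrite eq_sym.
Qed.

Lemma ndet_block2 (R : comNzRingType) p (a b c d : R) :
  a * d - b * c = 1 ->
  ndet p.*2 (fun i k => if i./2 == k./2 then
     (if odd i then (if odd k then d else c) else (if odd k then b else a))
     else 0) = 1.
Proof.
move=> abcd; elim: p => [|p IH]; first by rewrite /ndet det_mx00.
rewrite /ndet; set M := (X in \det X).
have -> : M = block_mx (n1 := 2) (m1 := 2) (\matrix_(i < 2, j < 2)
   (if odd i then (if odd j then d else c) else (if odd j then b else a))) 0 0
   (\matrix_(i < p.*2, k < p.*2) if i./2 == k./2 then
     (if odd i then (if odd k then d else c) else (if odd k then b else a))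
     else 0).
  apply/matrixP => i j; rewrite !mxE.
  case: (@splitP 2 p.*2 i) => i' ->; rewrite !mxE; case: (@splitP 2 p.*2 j) => j' ->; rewrite !mxE.
  - by case: i' => [[|[|]]] //; case: j' => [[|[|]]].
  - by case: i' => [[|[|]]].
  - by case: j' => [[|[|]]].
  - by rewrite !oddD /= eqSS.
rewrite /ndet in IH; rewrite [LHS](@det_ublock _ 2 p.*2) IH mulr1.
by rewrite (expand_det_row _ ord0) !big_ord_recl big_ord0 /cofactor !det_mx11 !mxE /=
     expr0 expr1 addr0 mul1r mulN1r mulrN.
Qed.

(** The row operation is left multiplication by the block-diagonal matrix of [ndet_block2], whose
    2x2 blocks all have determinant 1. *)
Lemma ndet_SL2 (R : comNzRingType) p (a b c d : R) (u v : nat -> nat -> R) :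
  a * d - b * c = 1 ->
  ndet p.*2 (fun i j => if odd i then c * u i./2 j + d * v i./2 j
                      else a * u i./2 j + b * v i./2 j)
  = ndet p.*2 (fun i j => if odd i then v i./2 j else u i./2 j).
Proof.
move=> abcd; rewrite -[RHS]mul1r -(@ndet_block2 _ p _ _ _ _ abcd) -ndet_mul.
apply: eq_ndet => i j ip jp.
rewrite (@sum_double _ p (fun k => (if i./2 == k./2 then
     (if odd i then (if odd k then d else c) else (if odd k then b else a))
     else 0) * (if odd k then v k./2 j else u k./2 j))).
pose F k := if odd i then c * u k j + d * v k j else a * u k j + b * v k j.
have ip2 : (i./2 < p)%N by lia.
rewrite -[LHS]/(F i./2) -(@sum_deltaE _ p _ F) //.
apply: eq_bigr => k _ /=; rewrite odd_double doubleK uphalf_double /F.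
by case: ifP; rewrite ?mul0r ?addr0 //; case: ifP.
Qed.

Lemma ndet_shear (R : comNzRingType) p (c d : R) (u w : nat -> nat -> R) :
  ndet p.*2 (fun i j => if odd i then
     (if i./2 is k.+1 then w k.+1 j + (c * u k j + d * u k.+1 j) else w 0%N j)
     else u i./2 j)
  = ndet p.*2 (fun i j => if odd i then w i./2 j else u i./2 j).
Proof.
(* Row 2k+3 receives multiples of rows 2k and 2k+2, both above it, so [l] is lower unitriangular. *)
pose l i k : R := if i == k then 1 else if [&& odd i, ~~ odd k & (0 < i./2)%N] then
   (if i./2 == k./2.+1 then c else 0) + (if i./2 == k./2 then d else 0) else 0.
rewrite -[RHS]mul1r -[X in X * _](@ndet_unitrig _ p.*2 l) -?ndet_mul; last 2 first.
- move=> i j ij; rewrite /l ifN; last by lia.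
  case: ifP => // H; rewrite !ifN ?addr0 //; apply/eqP; lia.
- by move=> i; rewrite /l eqxx.
apply: eq_ndet => i j ip jp.
rewrite (@sum_double _ p (fun k => l i k * (if odd k then w k./2 j else u k./2 j))).
have ip2 : (i./2 < p)%N by lia.
have E k : l i k.*2 * (if odd k.*2 then w k.*2./2 j else u k.*2./2 j)
   + l i k.*2.+1 * (if odd k.*2.+1 then w k.*2.+1./2 j else u k.*2.+1./2 j)
   = (if i./2 == k then (if odd i then w k j else u k j) else 0)
     + ((if odd i && (0 < i./2)%N then if i./2 == k.+1 then c * u k j else 0 else 0)
     + (if odd i && (0 < i./2)%N then if i./2 == k then d * u k j else 0 else 0)).
  rewrite /= odd_double /= uphalf_double doubleK /l /= odd_double /= uphalf_double doubleK.
  have e1 : (i == k.*2) = ~~ odd i && (i./2 == k) by lia.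
  have e2 : (i == k.*2.+1) = odd i && (i./2 == k) by lia.
  rewrite e1 e2 andbF.
  case: (odd i) => /=; case: (i./2 =P k) => h; case: (i./2 =P k.+1) => h';
    case: (0 < i./2)%N => /=;
    rewrite ?(mul1r, mul0r, add0r, addr0) ?mulrDl ?mul0r ?addr0 ?add0r //; try lia.
  by rewrite addrC.
rewrite (eq_bigr _ (fun (k : 'I_p) _ => E k)) !big_split /=.
rewrite (@sum_deltaE _ p _ (fun k => if odd i then w k j else u k j)) //.
case: (odd i) => /=; last by rewrite !big1_eq !addr0.
case: (i./2) ip2 => [|k] kp /=; first by rewrite !big1_eq !addr0.
rewrite (@sum_deltaE _ p _ (fun k => d * u k j)) //.
rewrite -(@sum_deltaE _ p k (fun k => c * u k j)) //; last by lia.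
Qed.

(* For [N = deg P], [p <= N] and [sg] the identity, rows 2k and 2k+1 list the
   coefficients of ['X^(p-1-k) * Q] and ['X^(p-1-k) * P] in degrees N+p-1, N+p-2, ...;
   [sg] selects columns. *)
Definition hurwitz_det (R : comNzRingType) (N p : nat) (sg : nat -> nat)
    (P Q : {poly R}) : R :=
  ndet p.*2 (fun i j => ((if odd i then P else Q) * 'X^(p.-1 - i./2))`_(N + p.-1 - sg j)).

Lemma eq_hurwitz_det (R : comNzRingType) N p sg sg' (P Q : {poly R}) :
  (forall j, (j < p.*2)%N -> sg j = sg' j) -> hurwitz_det N p sg P Q = hurwitz_det N p sg' P Q.
Proof. by move=> H; apply: eq_ndet => i j _ jp; rewrite H. Qed.

Lemma hurwitz_det_SL2 (R : comNzRingType) N p sg (a b c d : R) (P Q : {poly R}) :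
  a * d - b * c = 1 ->
  hurwitz_det N p sg (c *: Q + d *: P) (a *: Q + b *: P) = hurwitz_det N p sg P Q.
Proof.
move=> abcd; rewrite /hurwitz_det.
pose e (S : {poly R}) k j := (S * 'X^(p.-1 - k))`_(N + p.-1 - sg j).
have := @ndet_SL2 _ p _ _ _ _ (e Q) (e P) abcd; rewrite /e => H.
transitivity (ndet p.*2 (fun i j => if odd i then e P i./2 j else e Q i./2 j)).
  rewrite -H; apply: eq_ndet => i j _ _.
  by case: ifP => _; rewrite mulrDl coefD -!scalerAl !coefZ.
by apply: eq_ndet => i j _ _; case: ifP.
Qed.

(** One step of the Euclidean algorithm as row operations. Subtracting rows of [Q] turns every [P]
    row but the first into a row of [S]. The first two columns then have one pivot each,
    [P]_N.+1[and, once its row is removed,]Q[_N]. The top degree drops by 2 for the remaining rows,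
    hence the shift of [sg]. *)
Lemma hurwitz_det_step (R : comNzRingType) N p sg (c d : R) (P Q S : {poly R}) :
  P = (c *: 'X + d%:P) * Q + S ->
  (size P <= N.+2)%N -> (size Q <= N.+1)%N -> (size S <= N)%N ->
  sg 0%N = 0%N -> sg 1%N = 1%N -> (forall j, 1 < sg j.+2)%N ->
  hurwitz_det N.+1 p.+1 sg P Q =
  - (P`_N.+1 * Q`_N) * hurwitz_det N p (fun j => sg j.+2 - 2)%N Q (- S).
Proof.
move=> PE sP sQ sS sg0 sg1 sg2.
pose w k j := ((if k is 0%N then P else S) * 'X^(p - k))`_(N.+1 + p - sg j).
pose u k j := (Q * 'X^(p - k))`_(N.+1 + p - sg j).
have -> : hurwitz_det N.+1 p.+1 sg P Q
    = ndet p.+1.*2 (fun i j => if odd i then w i./2 j else u i./2 j).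
  rewrite -(@ndet_shear _ p.+1 c d); apply: eq_ndet => i j ip jp /=.
  case: (boolP (odd i)) => [oi|_]; last by [].
  have : (i./2 <= p)%N by lia.
  case: (i./2) => [|k] kp; first by rewrite /w subn0.
  have -> : P * 'X^(p - k.+1)
      = S * 'X^(p - k.+1) + (c *: (Q * 'X^(p - k)) + d *: (Q * 'X^(p - k.+1))).
    rewrite PE (_ : p - k = (p - k.+1).+1)%N ?exprS; last by lia.
    by rewrite -!mul_polyC; ring.
  by rewrite /w /u !coefD !coefZ.
have big0 (T : {poly R}) k m : (size T + k <= m)%N -> (T * 'X^k)`_m = 0.
  move=> H; rewrite coefMXn; case: ifP => // _; rewrite nth_default //.
  by move: H; move: (size T) => t; lia.
rewrite doubleS (@ndet_expand_col0 _ _ 1) //; last first.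
  case=> [|[|i]] //= ip _; first by rewrite /u sg0 big0 //; lia.
  by rewrite negbK; case: ifP => _; rewrite /u /w sg0 big0 //; lia.
rewrite (@ndet_expand_col0 _ _ 0) //; last first.
  case=> [|i] //= ip _; rewrite negbK /u /w sg1.
  by case: ifP => _; rewrite big0 //; lia.
rewrite expr1 expr0 /= /w /u sg0 sg1 !subn0 mul1r mulrA.
have -> : (P * 'X^p)`_(N.+1 + p) = P`_N.+1.
  by rewrite coefMXn ifN ?addnK //; lia.
have -> : (Q * 'X^p)`_(N.+1 + p - 1) = Q`_N.
  by rewrite coefMXn ifN; [congr (_`_ _)|]; lia.
rewrite mulN1r mulNr; congr (- _ * _); rewrite /hurwitz_det.
(* The remaining rows alternate [Q], [S]; the matrix with rows (0, 1) and (-1, 0), of determinant 1,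
   brings them to the order [- S], [Q]. *)
pose e (T : {poly R}) k j := (T * 'X^(p.-1 - k))`_(N + p.-1 - (sg j.+2 - 2)).
rewrite (@eq_ndet _ _ _ (fun i j => if odd i then -1 * e (- S) i./2 j + 0 * e Q i./2 j
    else 0 * e (- S) i./2 j + 1 * e Q i./2 j)).
  rewrite ndet_SL2 ?mul0r ?mulrN1 ?opprK ?add0r //.
  by apply: eq_ndet => i j _ _; case: ifP.
move=> i j ip jp; rewrite /bump /= ?add1n /= negbK !mul0r add0r addr0 mul1r /e.
have -> : (N.+1 + p - sg j.+2 = N + p.-1 - (sg j.+2 - 2))%N by have := sg2 j; lia.
have -> : (p - i./2.+1 = p.-1 - i./2)%N by lia.
by case: ifP => _ //; rewrite mulN1r mulNr coefN opprK.
Qed.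

(** * Pairs with positive minors *)

Lemma hurwitz_det_order1 (R : comNzRingType) N sg (P Q : {poly R}) :
  (size Q <= N.+1)%N -> sg 0%N = 0%N ->
  hurwitz_det N.+1 1 sg P Q = - (P`_N.+1 * Q`_(N.+1 - sg 1%N)).
Proof.
move=> sQ sg0; rewrite /hurwitz_det (@ndet_expand_col0 _ _ 1) //.
  rewrite (@ndet_expand_col0 _ _ 0) //; last by case.
  by rewrite /ndet det_mx00 /bump /= sg0 expr0 expr1 !mulr1 mul1r mulN1r mulNr subn0 addn0.
by case=> [|[|i]] //= _ _; rewrite sg0 expr0 mulr1 nth_default // addn0 subn0.
Qed.

Lemma quotient_linear (R : fieldType) N (P Q : {poly R}) :
  (size P <= N.+2)%N -> (size Q <= N.+1)%N -> Q`_N != 0 ->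
  exists (d : R) (S : {poly R}),
    P = ((P`_N.+1 / Q`_N) *: 'X + d%:P) * Q + S /\ (size S <= N)%N.
Proof.
move=> sP sQ Q0; set c := _ / _; pose P1 := P - c *: ('X * Q).
(* Subtracting [c *: ('X * Q)] has cancelled degree N+1; this constant cancels degree N. *)
exists (P1`_N / Q`_N), (P1 - (P1`_N / Q`_N) *: Q); split.
  by rewrite /P1 -!mul_polyC; ring.
apply/leq_sizeP => j; rewrite leq_eqVlt => /predU1P[<-|Nj].
  by rewrite coefB coefZ divfK // subrr.
rewrite coefB coefZ [Q`_j]nth_default ?(leq_trans sQ) // mulr0 subr0.
rewrite coefB coefZ coefXM; case: j Nj => // j; rewrite ltnS leq_eqVlt => /predU1P[<-|Nj] /=.
  by rewrite /c divfK // subrr.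
by rewrite !nth_default ?mulr0 ?subrr // (leq_trans sP, leq_trans sQ).
Qed.


(* [Im (P conj Q) = (|P + i Q|^2 - |P - i Q|^2) / 4]: this makes [P + i Q] dominate its
   conjugate below the real axis. *)
Definition upper_pair (R : rcfType) (P Q : {poly R}) : Prop :=
  forall z : R[i], complex.Im z <= 0 ->
    0 <= complex.Im ((toC P).[z] * ((toC Q).[z])^*%C) /\
    ~ ((toC P).[z] = 0 /\ (toC Q).[z] = 0).

(** The step adds [c Im z |Q(z)|^2] to the imaginary part, and this is nonnegative on the closed
    lower half plane. A common zero of the new pair is a common zero of [Q] and [S]. *)
Lemma upper_pair_step (R : rcfType) (c d : R) (Q S : {poly R}) :
  c <= 0 -> upper_pair Q (- S) -> upper_pair ((c *: 'X + d%:P) * Q + S) Q.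
Proof.
move=> c0 H z z0; have [H1 H2] := H z z0.
rewrite !(rmorphD, rmorphM) /= map_polyZ map_polyX map_polyC /= !hornerE.
rewrite rmorphN hornerN /= in H1 H2.
split; last by case=> + Q0; rewrite Q0 mulr0 add0r => S0; apply: H2; rewrite S0 oppr0.
move: H1 {H2}; case: (_.[z]) => a b; case: (_.[z]) => s t; case: z z0 => x y /= y0 H1.
have : 0 <= c * y * (a ^+ 2 + b ^+ 2).
  by rewrite mulr_ge0 ?addr_ge0 ?sqr_ge0 // mulr_le0.
simpc => /= h; nra.
Qed.

Lemma upper_pair_const (R : rcfType) (P : {poly R}) :
  (size P <= 1)%N -> P`_0 != 0 -> upper_pair P 0.
Proof.
move=> /size1_polyC -> P0 z _; rewrite coefC /= in P0.
rewrite rmorph0 horner0 map_polyC hornerC conjc0 mulr0; split=> // -[/eqP].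
by rewrite (inj_eq (@complexI R) _ 0) (negbTE P0).
Qed.

(** At a root, [P = - i Q], so [Im (P conj Q) = - |Q|^2]; in the closed lower half plane this forces
    [Q], and then [P], to vanish there. *)
Lemma upper_pair_root (R : rcfType) (P Q : {poly R}) (z : R[i]) :
  upper_pair P Q -> root (toC P + 'i%C *: toC Q) z -> 0 < complex.Im z.
Proof.
move=> PQ; rewrite rootE hornerD hornerZ; apply: contraTT; rewrite -leNgt => /PQ.
case: (_.[z]) => a b; case: (_.[z]) => s t [+ H].
rewrite eq_complex /=; simpc => /= h; apply/negP => /andP[/eqP e1 /eqP e2].
have s0 : s = 0 by nra.
have t0 : t = 0 by nra.
by apply: H; rewrite s0 t0; split=> //; congr Complex; lra.
Qed.

(** The columns of [nabla_tilde]. For [1 < N] the selector at [N.+1] fixes columns 0 and 1, and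
    shifting it by 2 gives the selector at [N]; at order 2 it moves column 1, so that order is the
    base case of [critical_factor]. *)
Definition tilde_col N j := if j == (2 * N - 3)%N then (2 * N - 2)%N else j.

(** The factor [k] is the first minor [- (P]_N.+1 * Q[_N)], and the leading quotient coefficient
    [P]_N.+1 / Q[_N] has the opposite sign. *)
Lemma quotient_step (R : realFieldType) N (P Q : {poly R}) :
  (size P <= N.+2)%N -> (size Q <= N.+1)%N -> 0 < hurwitz_det N.+1 1 id P Q ->
  exists c d S, [/\ P = (c *: 'X + d%:P) * Q + S, (size S <= N)%N, c < 0,
    Q`_N != 0 & exists2 k, 0 < k & forall p,
      hurwitz_det N.+1 p.+1 id P Q = k * hurwitz_det N p id Q (- S) /\
      ((1 < N)%N -> hurwitz_det N.+1 p.+1 (tilde_col N.+1) P Q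
         = k * hurwitz_det N p (tilde_col N) Q (- S))].
Proof.
move=> sP sQ; rewrite hurwitz_det_order1 // subn1 /= => k0.
have Q0 : Q`_N != 0 by apply: contraTneq k0 => ->; rewrite mulr0 oppr0 ltxx.
have [d [S [PE sS]]] := quotient_linear sP sQ Q0.
exists (P`_N.+1 / Q`_N), d, S; split=> //.
  have -> : P`_N.+1 / Q`_N = (P`_N.+1 * Q`_N) * (Q`_N ^- 2) by field.
  by rewrite nmulr_rlt0 ?invr_gt0 ?exprn_even_gt0 //; lra.
exists (- (P`_N.+1 * Q`_N)) => // p; split=> [|N1].
  rewrite (hurwitz_det_step _ PE) //; congr (_ * _).
  by apply: eq_hurwitz_det => j _; rewrite subn2.
rewrite (hurwitz_det_step _ PE) //; rewrite /tilde_col; try by case: eqP => //; lia.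
  by congr (_ * _); apply: eq_hurwitz_det => j _; do 2 case: eqP; lia.
by move=> j; case: eqP; lia.
Qed.

Lemma upper_pair_of_minors (R : rcfType) N (P Q : {poly R}) :
  (size P <= N.+1)%N -> (size Q <= N)%N -> P`_N != 0 ->
  (forall p, (0 < p <= N)%N -> 0 < hurwitz_det N p id P Q) -> upper_pair P Q.
Proof.
elim: N P Q => [|N IH] P Q sP sQ P0 H.
  have -> : Q = 0 by apply/eqP; rewrite -size_poly_leq0.
  exact: upper_pair_const.
have [c [d [S [PE sS c0 Q0 [k k0 kH]]]]] := quotient_step sP sQ (H 1%N isT).
rewrite {}PE in H kH *.
apply: upper_pair_step (ltW c0) _; apply: IH; rewrite ?size_polyN // => p pN.
by have := H p.+1; rewrite (kH p).1 pmulr_rgt0 //; apply; lia.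
Qed.

Lemma critical_factor (R : rcfType) N (P Q : {poly R}) :
  (size P <= N.+3)%N -> (size Q <= N.+2)%N -> P`_N.+2 != 0 ->
  (forall p, (0 < p < N.+2)%N -> 0 < hurwitz_det N.+2 p id P Q) ->
  hurwitz_det N.+2 N.+2 id P Q = 0 -> hurwitz_det N.+2 N.+1 (tilde_col N.+2) P Q < 0 ->
  exists r P1 Q1, [/\ 0 < r, P = ('X - r%:P) * P1, Q = ('X - r%:P) * Q1
    & upper_pair P1 Q1].
Proof.
elim: N P Q => [|N IH] P Q sP sQ P0 H H0 Ht.
  have [c [d [S [PE sS c0 Q0 [k k0 kH]]]]] := quotient_step sP sQ (H 1%N isT).
  (* The second minor is [k] times the product of [Q]_1[and the constant]S[, with]k[and]Q[_1]
     nonzero. *)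
  have S0 : S = 0.
    apply/eqP; rewrite -size_poly_leq0 leqn0 size_poly_eq0.
    move: H0; rewrite (kH 1%N).1 hurwitz_det_order1 ?size_polyN // subn1 coefN.
    move=> /eqP; rewrite !mulrN opprK !mulf_eq0 (gt_eqF k0) (negbTE Q0) /=.
    by rewrite {2}(size1_polyC sS) polyC_eq0.
  rewrite hurwitz_det_order1 //= in Ht; rewrite /= subnn in Ht.
  have := H 1%N isT; rewrite hurwitz_det_order1 //= subn1 /= => H1.
  have QE : Q = ('X - (- (Q`_0 / Q`_1))%:P) * (Q`_1)%:P.
    rewrite {1}(_ : Q = Q`_1 *: 'X + (Q`_0)%:P).
      by rewrite mulrBl -polyCM mulNr divfK // polyCN opprK -mul_polyC mulrC.
    apply/polyP => -[|[|i]]; rewrite coefD coefZ coefX coefC /=.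
    - by rewrite mulr0 add0r.
    - by rewrite mulr1 addr0.
    - by rewrite mulr0 addr0 nth_default // (leq_trans sQ).
  (* The common factor is [Q] itself up to a scalar. Its root is positive because [P]_2 * Q[_1 < 0]
     by the first minor and [P]_2 * Q[_0 > 0] by the modified one. *)
  exists (- (Q`_0 / Q`_1)), ((c *: 'X + d%:P) * (Q`_1)%:P), (Q`_1)%:P; split=> //.
  - have -> : - (Q`_0 / Q`_1) = - (P`_2 * Q`_1) * (P`_2 * Q`_0) / (P`_2 * Q`_1) ^+ 2.
      by field; rewrite Q0.
    apply: divr_gt0; first by apply: mulr_gt0; lra.
    by rewrite exprn_even_gt0 //= mulf_neq0.
  - by rewrite {1}PE S0 addr0 mulrCA -QE.
  - rewrite -[X in upper_pair X _]addr0; apply: upper_pair_step (ltW c0) _.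
    by rewrite oppr0; apply: upper_pair_const; rewrite ?size_polyC_leq1 ?coefC.
have [c [d [S [PE sS c0 Q0 [k k0 kH]]]]] := quotient_step sP sQ (H 1%N isT).
have [|||||r [Q1 [S1 [r0 QE SE U]]]] := IH Q (- S) _ _ Q0; rewrite ?size_polyN //.
- by move=> p pN; rewrite -(pmulr_rgt0 _ k0) -(kH p).1 H //; lia.
- by move/eqP: H0; rewrite (kH _).1 // mulf_eq0 gt_eqF //= => /eqP.
- by move: Ht; rewrite (kH _).2 // pmulr_rlt0.
(* A common factor of [Q] and [S] divides [P], and the cofactors satisfy the same division
   identity. *)
exists r, ((c *: 'X + d%:P) * Q1 - S1), Q1; split=> //.
  by rewrite {1}PE QE mulrBr -SE opprK mulrCA.
by apply: upper_pair_step (ltW c0) _; rewrite opprK.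
Qed.

(** * The Bezout form *)

(* [T] is the Bezoutian of [P] and [Q] at [y], whose image under [phi] does not depend
   on [y]; [phi] kills all the remainders of the Euclidean algorithm but the last. *)
Definition bezout_positive (R : rcfType) (N : nat) (P Q : {poly R}) : Prop :=
  exists (phi : {poly R[i]} -> R[i]) (k : R[i]),
    [/\ forall a p q, phi (a *: p + q) = a * phi p + phi q, phi 1 = 1, 0 < k
      & forall y : R[i], exists T : {poly R[i]}, [/\ (size T <= N)%N, phi T = k
          & ('X - y%:P) * T = (toC Q).[y] *: toC P - (toC P).[y] *: toC Q]].

(** The Bezoutian of [P, Q] is [c Q(x) Q(y)] plus that of [Q, - S]. The functional for the smaller
    pair is corrected so as to kill [Q], which leaves its values in degree at most N unchanged. *)
Lemma bezout_positive_of_minors (R : rcfType) N (P Q : {poly R}) :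
  (size P <= N.+2)%N -> (size Q <= N.+1)%N ->
  (forall p, (0 < p < N.+1)%N -> 0 < hurwitz_det N.+1 p id P Q) ->
  hurwitz_det N.+1 N.+1 id P Q < 0 -> bezout_positive N.+1 P Q.
Proof.
elim: N P Q => [|N IH] P Q sP sQ H Ht.
  move: Ht; rewrite hurwitz_det_order1 // subnn oppr_lt0 => k0.
  exists (coefp 0%N), (P`_1 * Q`_0)%:C%C; split=> [a p q|||y].
  - by rewrite /= coefD coefZ.
  - by rewrite /= coefC.
  - by rewrite ltcR.
  exists ((P`_1 * Q`_0)%:C%C)%:P; split; rewrite ?size_polyC_leq1 //= ?coefC //.
  have -> : P = P`_1 *: 'X + (P`_0)%:P.
    apply/polyP => -[|[|i]]; rewrite coefD coefZ coefX coefC /= ?mulr0 ?mulr1 ?add0r ?addr0 //.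
    by rewrite nth_default // (leq_trans sP).
  rewrite [Q in RHS]size1_polyC //.
  rewrite !(coefD, coefZ, coefX, coefC) /= mulr1 addr0.
  rewrite rmorphD /= map_polyZ map_polyX !map_polyC /= !hornerE rmorphM /=.
  by rewrite -!mul_polyC !rmorphD !rmorphM /=; ring.
have [c [d [S [PE sS c0 Q0 [k k0 kH]]]]] := quotient_step sP sQ (H 1%N isT).
have [||||phi [l [lin phi1 l0 phiT]]] := IH Q (- S); rewrite ?size_polyN //.
- by move=> p pN; have := H p.+1; rewrite (kH p).1 pmulr_rgt0 //; apply; lia.
- by move: Ht; rewrite (kH _).1 // pmulr_rlt0.
(* The top coefficient is used to arrange [psi (toC Q) = 0]. *)
pose psi (p : {poly R[i]}) := phi p - phi (toC Q) / (Q`_N.+1)%:C%C * p`_N.+1.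
have Q0C : (Q`_N.+1)%:C%C != 0 by rewrite (inj_eq (@complexI R) _ 0).
exists psi, l; split=> // [a p q||y].
- by rewrite /psi lin coefD coefZ; ring.
- by rewrite /psi phi1 coef1 mulr0 subr0.
have [T [sT TE TQ]] := phiT y.
exists (((c%:C)%C * (toC Q).[y]) *: toC Q + T); split.
- rewrite (leq_trans (size_polyD _ _)) // geq_max (leq_trans sT) // andbT.
  by rewrite (leq_trans (size_scale_leq _ _)) // size_map_poly.
- rewrite /psi lin coefD coefZ coef_map /= [T`_N.+1]nth_default // TE addr0.
  by field.
rewrite mulrDr TQ PE.
rewrite !(rmorphD, rmorphM) /= rmorphN /= map_polyZ map_polyX !map_polyC /= !hornerE.
by rewrite -!mul_polyC !(polyCD, polyCM, polyCN) /=; ring.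
Qed.

(** * Hermite's formula *)

Local Notation conjp := (map_poly (@conjc _)).

Lemma linear_form0 (R : nzRingType) (phi : {poly R} -> R) :
  (forall a p q, phi (a *: p + q) = a * phi p + phi q) -> phi 0 = 0.
Proof.
by move=> /(_ 1 0 0)/eqP; rewrite scale1r addr0 mul1r -subr_eq subrr => /eqP/esym.
Qed.

(* Write [K_F(x, y)] for the quotient by [x - y] of the right-hand side below. If
   [F = ('X - r) G], then [K_F(x, y) = (x - r^* ) (y - r) K_G(x, y) - Im r G(x) G^*(y)];
   [S] is [phi] applied to [K_F] in the variable [x]. *)
Lemma hermite_form_le0 (R : rcfType) (s : seq R[i]) (phi : {poly R[i]} -> R[i]) :
  (forall z, z \in s -> 0 <= complex.Im z) ->
  (forall a p q, phi (a *: p + q) = a * phi p + phi q) ->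
  let F := \prod_(z <- s) ('X - z%:P) in
  exists2 S : {poly R[i]}, phi (conjp S) <= 0 &
    forall (y : R[i]) (T : {poly R[i]}), ('X - y%:P) * T =
        ('i%C / 2) *: ((conjp F).[y] *: F - F.[y] *: conjp F) ->
      phi T = S.[y].
Proof.
elim: s phi => [|r s IH] phi s0 lin F.
  have phi0 := linear_form0 lin.
  exists 0; first by rewrite rmorph0 phi0.
  move=> y T; rewrite /F big_nil rmorph1 !hornerE !scale1r subrr scaler0.
  by move=> /eqP; rewrite mulf_eq0 polyXsubC_eq0 /= => /eqP ->.
pose G := \prod_(z <- s) ('X - z%:P).
have FE : F = ('X - r%:P) * G by rewrite /F big_cons.
have r0 : 0 <= complex.Im r by rewrite s0 ?mem_head.
(* [psi] absorbs the factor [x - conj r] of the recurrence for [K_F]. *)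
pose psi (p : {poly R[i]}) := phi (('X - (r^*)%C%:P) * p).
have [z zs|a p q|S S0 SE] := IH psi.
- by rewrite s0 // inE zs orbT.
- by rewrite /psi mulrDr -scalerAr lin.
pose t := ((complex.Im r)%:C)%C.
have tE : t = - ('i%C / 2 * (r - r^*%C)).
  transitivity (- ('i%C ^+ 2) * t); first by rewrite sqr_i opprK mul1r.
  by rewrite subcJ -/t; field.
(* Applying [phi] to the conjugate of this polynomial gives [psi (conjp S) - Im r |phi G|^2], a sum
   of two nonpositive terms. *)
exists (('X - r%:P) * S - (t * phi G) *: conjp G).
  rewrite rmorphB rmorphM /= map_polyZ rmorphB /= map_polyX map_polyC /=.
  have -> : conjp (conjp G) = G.
    by apply/polyP => i; rewrite !coef_map /= conjcK.
  rewrite addrC -scaleNr lin -/(psi _) rmorphM /= -[X in _ <= X]addr0 lerD //.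
  rewrite oppr0 mulNr -mulrA oppr_le0 mulr_ge0 ?ler0c //.
  by rewrite mulrC mulcJ_ge0.
move=> y T TE.
have [T1 T1E] : exists T1 : {poly R[i]}, ('i%C / 2) *: ((conjp G).[y] *: G - G.[y] *: conjp G)
    = ('X - y%:P) * T1.
  have : root (('i%C / 2) *: ((conjp G).[y] *: G - G.[y] *: conjp G)) y.
    by rewrite rootE !hornerE [X in _ - X]mulrC subrr mulr0 eqxx.
  by move=> /factor_theorem [T1 ->]; exists T1; rewrite mulrC.
have -> : T = (y - r) *: (('X - (r^*)%C%:P) * T1) + (- (t * (conjp G).[y])) *: G.
  apply: (mulfI (negbT (polyXsubC_eq0 y))); rewrite TE mulrDr.
  rewrite -scalerAr mulrCA -T1E FE rmorphM rmorphB /= map_polyX map_polyC /= tE.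
  rewrite !hornerE -!mul_polyC !(polyCM, polyCN, polyCB); ring.
rewrite lin -[_ *: G]addr0 lin (linear_form0 lin) addr0 -/(psi T1).
by rewrite (SE _ _ (esym T1E)) !hornerE; ring.
Qed.

Lemma horner_inj (R : numDomainType) (p q : {poly R}) :
  (forall x, p.[x] = q.[x]) -> p = q.
Proof.
move=> H; apply/eqP; rewrite -subr_eq0; apply/eqP.
apply: (@roots_geq_poly_eq0 _ _ [seq i%:R | i <- iota 0 (size (p - q))]).
- by apply/allP => x _; rewrite rootE !hornerE H subrr.
- by rewrite map_inj_uniq ?iota_uniq // => i j /eqP; rewrite eqr_nat => /eqP.
- by rewrite size_map size_iota.
Qed.

(** For [F = P + i Q] the Hermite kernel and the Bezoutian coincide. If no root were in the lower
    half plane, the polynomial [S] of [hermite_form_le0] would be the constant [k > 0], although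
    [phi (conjp S) <= 0]. *)
Lemma lower_root_of_minors (R : rcfType) N (P Q : {poly R}) (s : seq R[i]) :
  (size P <= N.+2)%N -> (size Q <= N.+1)%N ->
  (forall p, (0 < p < N.+1)%N -> 0 < hurwitz_det N.+1 p id P Q) ->
  hurwitz_det N.+1 N.+1 id P Q < 0 ->
  toC P + 'i%C *: toC Q = \prod_(z <- s) ('X - z%:P) ->
  exists2 z, z \in s & complex.Im z < 0.
Proof.
move=> sP sQ H Ht FE.
have [phi [k [lin phi1 k0 phiT]]] := bezout_positive_of_minors sP sQ H Ht.
apply/hasP; apply: contraT => /hasPn s0.
have [|S S0 SE] := hermite_form_le0 (s := s) _ lin.
  by move=> z /s0; rewrite -leNgt.
have SkE : S = k%:P.
  apply: horner_inj => y; rewrite hornerC; have [T [_ TE' TE]] := phiT y.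
  have conjF : conjp (toC P + 'i%C *: toC Q) = toC P - 'i%C *: toC Q.
    apply/polyP => j; rewrite !(coef_map, coefD, coefN, coefZ) /=.
    by apply/eqP; rewrite eq_complex /=; apply/andP; split; apply/eqP; ring.
  rewrite -TE' -(SE y T) // TE -FE conjF !hornerE.
  apply/polyP => j; rewrite !(coefN, coefZ, coefD).
  transitivity (- ('i%C ^+ 2) * ((toC Q).[y] * (toC P)`_j - (toC P).[y] * (toC Q)`_j)).
    by rewrite sqr_i opprK mul1r.
  by field.
have kR : complex.Im k = 0 by exact: ger0_Im (ltW k0).
have linC c : phi c%:P = c.
  by rewrite -[c%:P]addr0 -[c%:P]mulr1 mul_polyC lin phi1 (linear_form0 lin) addr0 mulr1.
move: S0; rewrite SkE map_polyC linC /=.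
have -> : (k^*)%C = k by case: k kR {k0 SkE phiT} => a b /= ->; rewrite oppr0.
by move=> /(lt_le_trans k0); rewrite ltxx.
Qed.

(** * Roots and the critical ray *)

Definition ray (R : realType) (alpha : R) : R[i] :=
  Complex (cos (alpha * pi / 2)) (sin (alpha * pi / 2)).

Lemma rayX (R : realType) (alpha : R) k :
  ray alpha ^+ k
    = Complex (cos (k%:R * alpha * pi / 2)) (sin (k%:R * alpha * pi / 2)).
Proof.
elim: k => [|k IH]; first by rewrite !mul0r cos0 sin0.
rewrite exprS IH /ray; simpc.
have -> : k.+1%:R * alpha * pi / 2 = alpha * pi / 2 + k%:R * alpha * pi / 2.
  by rewrite -natr1; ring.
by rewrite cosD sinD; congr Complex; ring.
Qed.

Lemma ray_conj (R : realType) (alpha : R) : ray alpha * (ray alpha)^*%C = 1.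
Proof.
rewrite /ray; simpc; rewrite -!expr2 cos2Dsin2; congr Complex; ring.
Qed.

(** [ray_im] and [ray_re] are the imaginary and real parts of [f(w x)] for real [x], where
    [w = ray alpha]. *)
Definition ray_im (R : realType) n (alpha : R) (f : {poly R}) : {poly R} :=
  \poly_(k < n.+1) (f`_k * sin (k%:R * alpha * pi / 2)).

Definition ray_re (R : realType) n (alpha : R) (f : {poly R}) : {poly R} :=
  \poly_(k < n.+1) (f`_k * cos (k%:R * alpha * pi / 2)).

(** The order [p] only shifts the exponent of 'X and the top degree together, so one matrix of
    entries serves all minors. The bound on [j] keeps the truncated subtraction exact. *)
Lemma RH_entryE (R : realType) n p (alpha : R) f i j :
  (i < p.*2)%N -> (j <= n + p.-1)%N ->
  RH_entry n alpha f i j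
  = ((if odd i then ray_re n alpha f else ray_im n alpha f)
      * 'X^(p.-1 - i./2))`_(n + p.-1 - j).
Proof.
move=> ip jp; rewrite /RH_entry coefMXn.
have ip2 : (i./2 <= p.-1)%N by lia.
case: ltnP => ji.
  rewrite ifN; last by lia.
  by case: ifP => _; rewrite coef_poly ifN //; lia.
have -> : (n + p.-1 - j < p.-1 - i./2)%N = (n < j - i./2)%N by lia.
rewrite /bbar /abar /hcoef leqNgt.
case: ltnP => /= nj; first by rewrite !mul0r if_same.
have -> : (n + p.-1 - j - (p.-1 - i./2) = n - (j - i./2))%N by lia.
have lt1 : (n - (j - i./2) < n.+1)%N by lia.
by case: ifP => _; rewrite coef_poly lt1.
Qed.

(** Real and imaginary parts of [w^-n f(w x)]. For monic [f] of degree n the factor [w^-n] makes the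
    leading coefficient 1, so that the imaginary part has degree below n. *)
Definition rot_re (R : realType) n (alpha : R) (f : {poly R}) : {poly R} :=
  sin (n%:R * alpha * pi / 2) *: ray_im n alpha f
  + cos (n%:R * alpha * pi / 2) *: ray_re n alpha f.

Definition rot_im (R : realType) n (alpha : R) (f : {poly R}) : {poly R} :=
  cos (n%:R * alpha * pi / 2) *: ray_im n alpha f
  + (- sin (n%:R * alpha * pi / 2)) *: ray_re n alpha f.

(** Multiplication by [w^-n] acts on the pair as a rotation, of determinant 1. *)
Lemma hurwitz_det_rot (R : realType) n p sg (alpha : R) f :
  hurwitz_det n p sg (rot_re n alpha f) (rot_im n alpha f)
  = hurwitz_det n p sg (ray_re n alpha f) (ray_im n alpha f).
Proof. by apply: hurwitz_det_SL2; rewrite mulNr opprK -!expr2 cos2Dsin2. Qed.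

Lemma nablaE (R : realType) n p (alpha : R) f : (p <= n)%N ->
  nabla n alpha f p = hurwitz_det n p id (rot_re n alpha f) (rot_im n alpha f).
Proof.
move=> pn; rewrite hurwitz_det_rot /nabla -/(ndet (2 * p) (RH_entry n alpha f)) mul2n.
by apply: eq_ndet => i j ip jp; rewrite (RH_entryE _ _ ip) //; lia.
Qed.

Lemma nabla_tildeE (R : realType) n (alpha : R) f : (2 <= n)%N ->
  nabla_tilde n alpha f
  = hurwitz_det n n.-1 (tilde_col n) (rot_re n alpha f) (rot_im n alpha f).
Proof.
move=> n2; rewrite hurwitz_det_rot /nabla_tilde
  -/(ndet (2 * n - 2) (fun i j => RH_entry n alpha f i (tilde_col n j))).
have -> : (2 * n - 2 = n.-1.*2)%N by lia.
apply: eq_ndet => i j ip jp; rewrite (RH_entryE _ _ ip) //.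
by rewrite /tilde_col; case: eqP; lia.
Qed.

Section Roots.
Variables (R : realType) (n : nat) (alpha : R) (f : {poly R}).
Hypotheses (fm : f \is monic) (sf : size f = n.+1).
Let w := ray alpha.

Lemma size_rot_re : (size (rot_re n alpha f) <= n.+1)%N.
Proof.
apply/leq_sizeP => j nj; rewrite coefD !coefZ !coef_poly ltnNge nj.
by rewrite !mulr0 addr0.
Qed.

Lemma size_rot_im : (size (rot_im n alpha f) <= n)%N.
Proof.
apply/leq_sizeP => j; rewrite leq_eqVlt => /predU1P[<-|nj].
  by rewrite coefD !coefZ !coef_poly ltnSn; ring.
by rewrite coefD !coefZ !coef_poly ltnNge nj !mulr0 addr0.
Qed.

Lemma lead_rot_re : (rot_re n alpha f)`_n = 1.
Proof.
rewrite coefD !coefZ !coef_poly ltnSn.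
have -> : f`_n = 1 by move/monicP: fm; rewrite lead_coefE sf.
by rewrite !mul1r -!expr2 addrC cos2Dsin2.
Qed.

(** Since [|w| = 1], [z * conj w] is [z / w]: substituting [w x] divides the roots by [w]. *)
Lemma rot_prod (s : seq R[i]) : toC f = \prod_(z <- s) ('X - z%:P) ->
  toC (rot_re n alpha f) + 'i%C *: toC (rot_im n alpha f)
  = \prod_(z <- [seq z * w^*%C | z <- s]) ('X - z%:P).
Proof.
move=> fs; have ss : size s = n.
  have := size_map_poly (real_complex R) f.
  by rewrite fs size_prod_XsubC sf => -[].
apply: horner_inj => x.
transitivity ((w^*%C) ^+ n * (toC f).[w * x]).
  rewrite (@horner_coef_wide _ n.+1); last first.
    apply/leq_sizeP => j nj; rewrite coefD coefZ !coef_map.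
    rewrite [(rot_re _ _ _)`_j]nth_default ?(leq_trans size_rot_re) //.
    rewrite [(rot_im _ _ _)`_j]nth_default ?(leq_trans size_rot_im) ?(ltnW nj) //.
    by rewrite !raddf0 mulr0 addr0.
  rewrite (@horner_coef_wide _ n.+1) ?size_map_poly ?sf // mulr_sumr.
  apply: eq_bigr => k _; rewrite exprMn -rmorphXn !rayX /=.
  rewrite coefD coefZ !coef_map /= !coefD !coefZ !coef_poly ltn_ord /=.
  rewrite [X in _ = X]mulrCA !mulrA; congr (_ * _).
  apply/eqP; rewrite eq_complex /=; apply/andP; split; apply/eqP; ring.
rewrite fs !horner_prod big_map -ss; elim: s {fs ss} => [|z s IH].
  by rewrite !big_nil expr0 mul1r.
rewrite !big_cons -{}IH exprS mulrACA !hornerE; congr (_ * _).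
by rewrite mulrBr mulrA [_ * w]mulrC ray_conj mul1r mulrC.
Qed.

(** The conclusion puts [z] in the open half plane lying counterclockwise from the ray through
    [w]. *)
Lemma roots_right_of_ray (s : seq R[i]) :
  toC f = \prod_(z <- s) ('X - z%:P) ->
  (forall p, (0 < p <= n)%N -> 0 < nabla n alpha f p) ->
  forall z, z \in s -> 0 < complex.Im (z * w^*%C).
Proof.
move=> fs H z zs.
have U : upper_pair (rot_re n alpha f) (rot_im n alpha f).
  apply: (upper_pair_of_minors size_rot_re size_rot_im).
    by rewrite lead_rot_re oner_eq0.
  by move=> p /andP[p0 pn]; rewrite -nablaE // H // p0.
apply: (upper_pair_root U).
by rewrite (rot_prod fs) root_prod_XsubC; apply/mapP; exists z.
Qed.

Lemma root_on_ray (s : seq R[i]) : (2 <= n)%N ->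
  toC f = \prod_(z <- s) ('X - z%:P) ->
  (forall p, (0 < p <= n - 1)%N -> 0 < nabla n alpha f p) ->
  nabla n alpha f n = 0 -> nabla_tilde n alpha f < 0 ->
  exists r t, [/\ 0 < r, perm_eq s ((r%:C)%C * w :: t)
    & forall z, z \in t -> 0 < complex.Im (z * w^*%C)].
Proof.
move=> n2 fs H H0 Ht.
have [N nE] : exists N, n = N.+2 by exists (n - 2)%N; lia.
have [r [P1 [Q1 [r0 PE QE U]]]] : exists r P1 Q1, [/\ 0 < r,
    rot_re n alpha f = ('X - r%:P) * P1, rot_im n alpha f = ('X - r%:P) * Q1
    & upper_pair P1 Q1].
  apply: (@critical_factor _ N); rewrite -?nE ?size_rot_re ?size_rot_im //.
  - by rewrite lead_rot_re oner_eq0.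
  - by move=> p /andP[p0 pn]; rewrite -nablaE ?H ?p0 //; lia.
  - by rewrite -nablaE.
  - have -> : N.+1 = n.-1 by rewrite nE.
    by rewrite -nabla_tildeE.
have FE := rot_prod fs; rewrite PE QE !rmorphM rmorphB /= map_polyX map_polyC /= in FE.
rewrite scalerAr -mulrDr in FE.
have : (r%:C)%C \in [seq z * w^*%C | z <- s].
  by rewrite -root_prod_XsubC -FE rootM root_XsubC eqxx.
case/mapP => z zs rE.
have zE : (r%:C)%C * w = z by rewrite rE -mulrA [_ * w]mulrC ray_conj mulr1.
exists r, (rem z s); split=> //; first by rewrite zE perm_to_rem.
move=> y yt; apply: (upper_pair_root U).
(* Cancelling the common factor leaves the cofactor pair, whose roots are the remaining ones divided
   by [w]. *)
rewrite (perm_big _ (perm_map _ (perm_to_rem zs))) /= big_cons -rE in FE.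
by rewrite (mulfI (negbT (polyXsubC_eq0 _)) FE) root_prod_XsubC; apply/mapP; exists y.
Qed.

Lemma root_left_of_ray (s : seq R[i]) : (1 <= n)%N ->
  toC f = \prod_(z <- s) ('X - z%:P) ->
  (forall p, (0 < p <= n - 1)%N -> 0 < nabla n alpha f p) ->
  nabla n alpha f n < 0 ->
  exists2 z, z \in s & complex.Im (z * w^*%C) < 0.
Proof.
move=> n1 fs H H0.
have [N nE] : exists N, n = N.+1 by exists (n - 1)%N; lia.
have [||||_ /mapP[z zs ->] z0] := @lower_root_of_minors _ N (rot_re n alpha f)
  (rot_im n alpha f) _ _ _ _ _ (rot_prod fs); rewrite -?nE ?size_rot_re ?size_rot_im //.
- by move=> p /andP[p0 pn]; rewrite -nablaE ?H ?p0 //; lia.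
- by rewrite -nablaE.
- by exists z.
Qed.
End Roots.

(** * Continuity of roots *)

Lemma cvg_sumr (K : numFieldType) T (F : set_system T) (I : Type) (r : seq I)
    (f : I -> T -> K) (l : I -> K) : Filter F ->
  (forall i, f i @ F --> l i) ->
  (fun t => \sum_(i <- r) f i t) @ F --> \sum_(i <- r) l i.
Proof. by move=> FF H; apply: cvg_big => //; exact: add_continuous. Qed.

Lemma cvg_prodr (K : numFieldType) T (F : set_system T) (I : Type) (r : seq I)
    (f : I -> T -> K) (l : I -> K) : Filter F ->
  (forall i, f i @ F --> l i) ->
  (fun t => \prod_(i <- r) f i t) @ F --> \prod_(i <- r) l i.
Proof. by move=> FF H; apply: cvg_big => //; exact: mul_continuous. Qed.

Lemma cvg_det (K : numFieldType) T (F : set_system T) N (A : T -> 'M[K]_N)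
    (B : 'M[K]_N) : Filter F ->
  (forall i j, (fun t => A t i j) @ F --> B i j) ->
  (fun t => \det (A t)) @ F --> \det B.
Proof.
move=> FF H; rewrite /determinant; apply: cvg_sumr => s.
by apply: cvgM; [exact: cvg_cst|apply: cvg_prodr => i].
Qed.

(** The smallest factor, to the power of the number of factors, is at most the product. With [x] a
    root of the limit polynomial the product tends to 0, so some root of the nearby polynomial tends
    to [x]. *)
Lemma nearest (K : numFieldType) (x z : K) (s : seq K) : z \in s ->
  exists2 y, y \in s & `|x - y| ^+ size s <= \prod_(w <- s) `|x - w|.
Proof.
move=> zs.
have [y ys ymin] : exists2 y, y \in s & {in s, forall w, `|x - y| <= `|x - w|}.
  elim: s z zs => // w s IH _ _; case: s IH => [|v s] IH.
    by exists w; rewrite ?mem_head // => u; rewrite inE => /eqP ->.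
  have [y ys ymin] := IH v (mem_head _ _).
  (* The order of [K] is partial, but norms are real and hence comparable. *)
  have [wy|yw] := real_leP (normr_real (x - w)) (normr_real (x - y)).
    exists w; rewrite ?mem_head // => u; rewrite inE => /predU1P[->//|us].
    exact: le_trans wy (ymin _ us).
  exists y; first by rewrite inE ys orbT.
  by move=> u; rewrite inE => /predU1P[->|/ymin//]; exact: ltW.
exists y => //; elim: s ymin {zs ys} => [|w s IH] ymin; first by rewrite big_nil.
rewrite exprS big_cons ler_pM ?exprn_ge0 ?ymin ?mem_head // IH // => u us.
by rewrite ymin // inE us orbT.
Qed.

(** Synthetic division recovers the coefficients of the quotient from the top down, each depending
    continuously on the later ones and on the root. *)
Lemma cvg_deflate (K : numFieldType) T (F : set_system T) (n : nat)
    (z : T -> K) (z0 : K) (p : T -> {poly K}) (p0 : {poly K}) : Filter F ->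
  z @ F --> z0 -> (forall t, (size (p t) <= n)%N) -> (size p0 <= n)%N ->
  (forall i, (fun t => (('X - (z t)%:P) * p t)`_i) @ F
     --> (('X - z0%:P) * p0)`_i) ->
  forall i, (fun t => (p t)`_i) @ F --> p0`_i.
Proof.
move=> FF zz0 sp sp0 H.
suff : forall d i, (n <= i + d)%N -> (fun t => (p t)`_i) @ F --> p0`_i.
  by move=> + i; apply; exact: leq_addl.
elim=> [|d IH] i nid.
  rewrite addn0 in nid; rewrite nth_default ?(leq_trans sp0) //.
  rewrite (_ : (fun t => _) = cst 0); first exact: cvg_cst.
  by apply/funext => t; rewrite nth_default // (leq_trans (sp t)).
have E (q : {poly K}) y : q`_i = (('X - y%:P) * q)`_i.+1 + y * q`_i.+1.
  by rewrite mulrBl coefB coefXM coefCM subrK.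
rewrite (E _ z0) (_ : (fun t => _) = (fun t => (('X - (z t)%:P) * p t)`_i.+1 + z t * (p t)`_i.+1)).
  by apply: cvgD (H _) _; apply: cvgM zz0 _; apply: IH; rewrite addSnnS.
by apply/funext => t; exact: E.
Qed.

(** At each [t] the root nearest to [z0] is taken out; it tends to [z0], the quotient converges by
    [cvg_deflate], and the induction applies to it. *)
Lemma roots_continuous (K : numFieldType) T (F : set_system T)
    (s0 : seq K) (s : T -> seq K) : Filter F ->
  (forall t, size (s t) = size s0) ->
  (forall i, (fun t => (\prod_(z <- s t) ('X - z%:P))`_i) @ F
     --> (\prod_(z <- s0) ('X - z%:P))`_i) ->
  exists s' : T -> seq K, (forall t, perm_eq (s t) (s' t)) /\
    (forall i, (i < size s0)%N -> (fun t => (s' t)`_i) @ F --> s0`_i).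
Proof.
move=> FF; elim: s0 s => [|z0 s0 IH] s ss H.
  by exists s.
have ex t : exists2 y, y \in s t
    & `|z0 - y| ^+ size (s t) <= \prod_(w <- s t) `|z0 - w|.
  apply: (@nearest _ z0 (s t)`_0); by rewrite mem_nth // ss.
pose z t := projT1 (cid2 (ex t)).
have zs t : z t \in s t by rewrite /z; case: (cid2 _).
have zle t : `|z0 - z t| ^+ size (s t) <= \prod_(w <- s t) `|z0 - w|.
  by rewrite /z; case: (cid2 _).
have zz0 : z @ F --> z0.
  have h0 : (fun t => (\prod_(w <- s t) ('X - w%:P)).[z0]) @ F --> (0 : K).
    have -> : (0 : K) = (\prod_(w <- z0 :: s0) ('X - w%:P)).[z0].
      by rewrite big_cons hornerM !hornerE subrr mul0r.
    rewrite (@horner_coef_wide _ (size s0).+2); last by rewrite size_prod_XsubC.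
    rewrite (_ : (fun t => _) = (fun t => \sum_(i < (size s0).+2)
        (\prod_(w <- s t) ('X - w%:P))`_i * z0 ^+ i)).
      by apply: cvg_sumr => i; apply: cvgM; [exact: H|exact: cvg_cst].
    apply/funext => t; rewrite (@horner_coef_wide _ (size s0).+2) //.
    by rewrite size_prod_XsubC ss.
  apply/cvgrPdist_lt => e e0.
  have en : 0 < e ^+ (size s0).+1 by rewrite exprn_gt0.
  move/cvgrPdist_lt/(_ _ en): h0 => h0; near=> t.
  have : `|0 - (\prod_(w <- s t) ('X - w%:P)).[z0]| < e ^+ (size s0).+1 by near: t.
  rewrite sub0r normrN horner_prod normr_prod => h.
  rewrite -(@ltr_pXn2r _ (size s0).+1) ?nnegrE ?normr_ge0 ?ltW //.
  have := zle t; rewrite ss => zle'.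
  apply: (le_lt_trans zle').
  by move: h; under eq_bigr do rewrite hornerXsubC.
pose r t := rem (z t) (s t).
have rE t : \prod_(w <- s t) ('X - w%:P) = ('X - (z t)%:P) * \prod_(w <- r t) ('X - w%:P).
  by rewrite (perm_big _ (perm_to_rem (zs t))) big_cons.
have sr t : size (r t) = size s0 by rewrite size_rem // ss.
have [|s' [s'p s'c]] := IH r sr.
  apply: (@cvg_deflate _ _ _ (size s0).+1 z z0) => //.
  - by move=> t; rewrite size_prod_XsubC sr.
  - by rewrite size_prod_XsubC.
  - move=> i; have := H i; rewrite big_cons.
    by rewrite (_ : (fun t => _) = (fun t => (('X - (z t)%:P) * \prod_(w <- r t) ('X - w%:P))`_i))
        //; apply/funext => t; rewrite rE.
exists (fun t => z t :: s' t); split=> [t|[|i] si].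
- by apply: perm_trans (perm_to_rem (zs t)) _; rewrite perm_cons s'p.
- exact: zz0.
- exact: s'c.
Unshelve. all: by end_near. Qed.

(** * The sector function *)

Lemma normc_sqr (R : rcfType) (z : R[i]) :
  Normc.normc z ^+ 2 = complex.Re z ^+ 2 + complex.Im z ^+ 2.
Proof. by case: z => a b; rewrite sqr_sqrtr // addr_ge0 ?sqr_ge0. Qed.

Lemma normc_nneg (R : rcfType) (z : R[i]) : 0 <= Normc.normc z.
Proof. by case: z => a b; exact: sqrtr_ge0. Qed.

Lemma Re_le_normc (R : rcfType) (z : R[i]) : `|complex.Re z| <= Normc.normc z.
Proof.
rewrite -(@ler_pXn2r _ 2) ?nnegrE ?normr_ge0 ?normc_nneg // real_normK ?num_real //.
by rewrite normc_sqr lerDl sqr_ge0.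
Qed.

Lemma Im_le_normc (R : rcfType) (z : R[i]) : `|complex.Im z| <= Normc.normc z.
Proof.
rewrite -(@ler_pXn2r _ 2) ?nnegrE ?normr_ge0 ?normc_nneg // real_normK ?num_real //.
by rewrite normc_sqr lerDr sqr_ge0.
Qed.

Lemma normc_conjc (R : rcfType) (z : R[i]) : Normc.normc (z^*)%C = Normc.normc z.
Proof. by case: z => a b /=; rewrite sqrrN. Qed.

(* Negative, zero or positive in the stable region, on the critical line and in the
   unstable region respectively, since [Re z = |z| cos (arg z)]. *)
Definition sector (R : realType) (alpha : R) (z : R[i]) : R :=
  complex.Re z - Normc.normc z * cos (alpha * pi / 2).

Lemma sector_conjc (R : realType) (alpha : R) (z : R[i]) :
  sector alpha (z^*)%C = sector alpha z.
Proof. by rewrite /sector normc_conjc; case: z. Qed.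

(** Carries strict inequalities from a limit root to nearby roots. The constant 2 suits [sector],
    where the real part and the modulus term contribute at most 1 each. *)
Lemma lipschitz_near (R : rcfType) T (F : set_system T) (u : R[i] -> R)
    (a : T -> R[i]) (l : R[i]) (c : R) : Filter F ->
  (forall x y, `|u x - u y| <= 2 * Normc.normc (x - y)) ->
  (a : T -> R[i]^o) @ F --> (l : R[i]^o) -> c < u l ->
  \forall t \near F, c < u (a t).
Proof.
move=> FF lip al cl.
have e0 : (0 : R[i]) < (((u l - c) / 2)%:C)%C by rewrite ltcR divr_gt0 // subr_gt0.
move/cvgrPdist_lt/(_ _ e0): al => al; near=> t.
have : `|l - a t| < (((u l - c) / 2)%:C)%C by near: t.
rewrite normc_def ltcR => h; have := lip l (a t).
have -> : Normc.normc (l - a t)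
    = Num.sqrt (complex.Re (l - a t) ^+ 2 + complex.Im (l - a t) ^+ 2).
  by rewrite -normc_sqr sqrtr_sqr ger0_norm // normc_nneg.
move: h; set N := Num.sqrt _ => h; rewrite ler_norml => /andP[_ h2]; lra.
Unshelve. all: by end_near. Qed.

Lemma lipschitz_Im (R : rcfType) (x y : R[i]) :
  `|complex.Im x - complex.Im y| <= 2 * Normc.normc (x - y).
Proof.
have := Im_le_normc (x - y); have := normc_nneg (x - y).
have -> : complex.Im (x - y) = complex.Im x - complex.Im y by case: x; case: y.
lra.
Qed.

Lemma lipschitz_sector (R : realType) (alpha : R) (x y : R[i]) :
  `|sector alpha x - sector alpha y| <= 2 * Normc.normc (x - y).
Proof.
have e : complex.Re (x - y) = complex.Re x - complex.Re y by case: x; case: y.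
have hR := Re_le_normc (x - y); have h0 := normc_nneg (x - y); rewrite {}e in hR.
have t1 : Normc.normc x <= Normc.normc (x - y) + Normc.normc y.
  by have := le_normcD (x - y) y; rewrite subrK.
have t2 : Normc.normc y <= Normc.normc (x - y) + Normc.normc x.
  by have := le_normcD (y - x) x; rewrite subrK -(normcN (y - x)) opprB.
set c := cos (alpha * pi / 2).
have cle : `|(Normc.normc x - Normc.normc y) * c| <= Normc.normc (x - y).
  rewrite normrM -[leRHS]mulr1 ler_pM // ?ler_norml ?cos_le1 ?cos_geN1 //; lra.
rewrite /sector -/c; move: hR cle; rewrite !ler_norml => /andP[? ?] /andP[? ?].
apply/andP; split; lra.
Qed.

Section Regions.
Variables (R : realType) (alpha : R).
Hypothesis alpha12 : 1 < alpha < 2.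
Let w := ray alpha.

Lemma theta_itv : 0 < alpha * pi / 2 < pi.
Proof. have := pi_gt0 R; case/andP: alpha12 => a1 a2 p; apply/andP; split; nra. Qed.

Lemma cos_theta_lt0 : cos (alpha * pi / 2) < 0.
Proof.
rewrite -(@cos_pihalf R) ltr_cos ?in_itv /=.
- have := pi_gt0 R; case/andP: alpha12 => a1 a2 p; nra.
- by have := pi_gt0 R => p; apply/andP; split; lra.
- by have /andP[/ltW-> /ltW->] := theta_itv.
Qed.

Lemma sin_theta_gt0 : 0 < sin (alpha * pi / 2).
Proof. by have /andP[? ?] := theta_itv; apply: sin_gt0_pi; rewrite ?in_itv /=; apply/andP. Qed.

(** With [N = |z|], the sign of [sector] compares two cosines of angles in [0, pi], where the cosine
    is decreasing. *)
Lemma sector_arg (z : R[i]) : z != 0 -> exists2 N, 0 < N &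
  sector alpha z = N * (cos `|arg z| - cos (alpha * pi / 2)) /\ 0 <= `|arg z| <= pi.
Proof.
move=> z0; exists (Normc.normc z).
  rewrite lt_neqAle normc_nneg andbT eq_sym; apply: contra z0 => /eqP/Normc.eq0_normc ->.
  by [].
have [/andP[a1 a2] zE] := argP z0; split; last first.
  by rewrite normr_ge0 /= ler_norml a2 andbT; lra.
rewrite /sector {1}zE /= mulrBr; congr (_ * _ - _).
by case: (ler0P (arg z)) => _ //; rewrite cosN.
Qed.

Lemma stableP (z : R[i]) : z != 0 -> sector alpha z < 0 -> stable_region alpha z.
Proof.
move=> z0; have [N N0 [-> aI]] := sector_arg z0; rewrite pmulr_rlt0 // subr_lt0.
rewrite ltr_cos ?in_itv //=.
by have /andP[/ltW-> /ltW->] := theta_itv.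
Qed.

Lemma unstableP (z : R[i]) : z != 0 -> 0 < sector alpha z -> unstable_region alpha z.
Proof.
move=> z0; have [N N0 [-> aI]] := sector_arg z0; rewrite pmulr_rgt0 // subr_gt0.
rewrite ltr_cos ?in_itv //=.
by have /andP[/ltW-> /ltW->] := theta_itv.
Qed.

Lemma criticalP (z : R[i]) : z != 0 -> sector alpha z = 0 -> critical_line alpha z.
Proof.
move=> z0; have [N N0 [-> aI]] := sector_arg z0 => /eqP.
rewrite mulf_eq0 gt_eqF //= subr_eq0 => /eqP h; split => //.
apply: cos_inj h; rewrite in_itv //=.
by have /andP[/ltW-> /ltW->] := theta_itv.
Qed.

(** For [z = x + i y] the hypotheses read [|y c| < - x s], whence [x < 0] and [y^2 c^2 < x^2 s^2].
    Adding [x^2 c^2] gives [|z|^2 c^2 < x^2], that is [x < |z| c] because [x] and [c] are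
    negative. *)
Lemma sector_lt0 (z : R[i]) :
  0 < complex.Im (z * w^*%C) -> 0 < complex.Im ((z^*)%C * w^*%C) -> sector alpha z < 0.
Proof.
rewrite /sector /w /ray; have := normc_sqr z; have := normc_nneg z.
have := cos_theta_lt0; have := sin_theta_gt0; have := cos2Dsin2 (alpha * pi / 2).
set c := cos _; set s := sin _; case: z => x y; set N := Normc.normc _ => cs s0 c0 N0 /= N2.
simpc => /= h1 h2.
have x0 : x < 0 by nra.
have h : (y * c) ^+ 2 < (x * s) ^+ 2 by nra.
rewrite subr_lt0 -ltrN2 -mulrN.
rewrite -(@ltr_pXn2r _ 2) ?nnegrE ?mulr_ge0 ?oppr_ge0 ?(ltW c0) ?(ltW x0) //.
rewrite exprMn !sqrrN N2.
have -> : x ^+ 2 = x ^+ 2 * (c ^+ 2 + s ^+ 2) by rewrite cs mulr1.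
nra.
Qed.

Lemma sector_le0 (z : R[i]) : sector alpha z <= 0 -> 0 <= complex.Im (z * w^*%C).
Proof.
rewrite /sector /w /ray; have := normc_sqr z; have := normc_nneg z.
have := cos_theta_lt0; have := sin_theta_gt0; have := cos2Dsin2 (alpha * pi / 2).
set c := cos _; set s := sin _; case: z => x y; set N := Normc.normc _ => cs s0 c0 N0 /= N2.
simpc => /= h; rewrite leNgt; apply/negP => h1.
have h2 : N * - c <= - x by lra.
have x0 : x <= 0 by nra.
have h3 : N ^+ 2 * c ^+ 2 <= x ^+ 2.
  rewrite -(sqrrN c) -exprMn -(sqrrN x).
  by rewrite ler_pXn2r // nnegrE ?mulr_ge0 ?oppr_ge0 // ltW.
have h4 : (y * c) ^+ 2 <= (x * s) ^+ 2.
  rewrite N2 in h3.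
  have -> : (x * s) ^+ 2 = x ^+ 2 - x ^+ 2 * c ^+ 2 by rewrite -[X in X - _]mulr1 -cs; ring.
  rewrite exprMn; lra.
have a0 : 0 <= - (x * s) by nra.
have b0 : - (x * s) < - (y * c) by lra.
have : (- (x * s)) ^+ 2 < (- (y * c)) ^+ 2.
  by rewrite ltr_pXn2r // nnegrE // ltW // (le_lt_trans a0).
rewrite !sqrrN; lra.
Qed.
End Regions.

(** * Following the critical pair *)

Lemma uniform_neg (R : realFieldType) (T : eqType) (u : T -> R) (s : seq T) :
  (forall z, z \in s -> u z < 0) ->
  exists2 e, 0 < e & forall z, z \in s -> u z < - e.
Proof.
elim: s => [|y s IH] H; first by exists 1.
have [z zs|e e0 He] := IH; first by rewrite H // inE zs orbT.
have y0 : u y < 0 by rewrite H ?mem_head.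
have [e1 [e10 e1e e1y]] : exists e1, [/\ 0 < e1, e1 <= e & u y < - e1].
  have [ey|ye] := lerP e (- u y / 2); first by exists e; split=> //; lra.
  by exists (- u y / 2); split; lra.
exists e1 => // z; rewrite inE => /predU1P[->//|/He]; lra.
Qed.

Lemma cvg_real_complex (R : realType) T (F : set_system T) (u : T -> R) (l : R) :
  Filter F -> u @ F --> l ->
  (fun t => ((u t)%:C)%C : R[i]^o) @ F --> ((l%:C)%C : R[i]^o).
Proof.
move=> FF ul; apply/cvgrPdist_lt => -[e b]; rewrite ltcE /= => /andP[/eqP -> e0].
move/cvgrPdist_lt/(_ _ e0): ul => ul; near=> t.
rewrite -rmorphB normc_def /= expr0n addr0 sqrtr_sqr ltcR.
by near: t.
Unshelve. all: by end_near. Qed.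

(** The threshold [- e] separates the pair from the other roots and stays fixed while the polynomial
    varies; the sign of the imaginary part then singles out [a]. *)
Definition pair_and_rest (R : realType) (alpha e : R) (p : {poly R})
    (a : R[i]) (t : seq R[i]) : Prop :=
  [/\ toC p = ('X - a%:P) * ('X - (a^*)%C%:P) * \prod_(z <- t) ('X - z%:P),
    0 < complex.Im a, - e < sector alpha a
    & forall z, z \in t -> sector alpha z < - e].

Lemma pair_roots (R : realType) (alpha e : R) p a t :
  pair_and_rest alpha e p a t -> toC p = \prod_(z <- [:: a, (a^*)%C & t]) ('X - z%:P).
Proof. by case=> -> _ _ _; rewrite !big_cons mulrA. Qed.

Lemma root_conjc (R : rcfType) (p : {poly R}) (z : R[i]) :
  root (toC p) z -> root (toC p) (z^*)%C.
Proof.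
rewrite !rootE => /eqP pz.
have -> : toC p = map_poly (@conjc R) (toC p).
  by apply/polyP => i; rewrite !coef_map /= oppr0.
by rewrite horner_map pz rmorph0.
Qed.

Lemma pair_unique (R : realType) (alpha e : R) p a t b :
  pair_and_rest alpha e p a t -> root (toC p) b -> 0 < complex.Im b ->
  - e < sector alpha b -> b = a.
Proof.
move=> H; have [_ a0 _ Ht] := H; rewrite (pair_roots H) root_prod_XsubC !inE.
move=> /or3P[/eqP //|/eqP -> |/Ht bt] b0 be; last by move: (lt_trans be bt); rewrite ltxx.
by case: a a0 b0 {H be} => x y /= y0; rewrite oppr_gt0 ltNge ltW.
Qed.

(** The inequalities that define the pair and the rest are strict, so they pass to nearby roots. It
    serves both for the existence of the pair near the critical parameter and for its continuity. *)
Lemma pair_near (R : realType) (alpha e : R) (n : nat) T (F : set_system T)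
    (f : T -> {poly R}) (p : {poly R}) a t0 : Filter F ->
  (forall t, f t \is monic) -> (forall t, size (f t) = n) -> size p = n ->
  (forall i, (fun t => (f t)`_i) @ F --> p`_i) ->
  pair_and_rest alpha e p a t0 -> forall d : R[i], 0 < d ->
  \forall t \near F, exists b r, pair_and_rest alpha e (f t) b r /\ `|a - b| < d.
Proof.
move=> FF fm sf sp fc H d d0.
pose s t := projT1 (closed_field_poly_normal (toC (f t))).
have sE t : toC (f t) = \prod_(z <- s t) ('X - z%:P).
  rewrite /s; case: (closed_field_poly_normal _) => r /= {1}->.
  have : toC (f t) \is monic by rewrite map_monic.
  by move/monicP => ->; rewrite scale1r.
have ss t : size (s t) = size [:: a, (a^*)%C & t0].
  have := size_map_poly (real_complex R) (f t).
  rewrite sf -sp -(size_map_poly (real_complex R)) (pair_roots H) sE.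
  by rewrite !size_prod_XsubC => -[].
have [|s' [sp' sc]] := @roots_continuous _ T F _ s FF ss.
  move=> i; rewrite -(pair_roots H) coef_map.
  rewrite (_ : (fun t => _) = (fun t => ((f t)`_i)%:C%C)).
    exact: cvg_real_complex.
  by apply/funext => t; rewrite -sE coef_map.
have [_ a0 ae Ht] := H.
have c0 := sc 0%N isT.
have n1 : \forall t \near F, 0 < complex.Im (s' t)`_0.
  exact: (lipschitz_near FF (@lipschitz_Im R) c0 a0).
have n2 : \forall t \near F, - e < sector alpha (s' t)`_0.
  exact: (lipschitz_near FF (@lipschitz_sector R alpha) c0 ae).
have n3 : \forall t \near F, `|a - (s' t)`_0| < d.
  by move/cvgrPdist_lt : c0; apply.
have n4 : \forall t \near F, forall i : 'I_(size t0), e < - sector alpha (s' t)`_i.+2.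
  apply: filter_forall => i.
  apply: (lipschitz_near (u := fun z => - sector alpha z) FF _ (sc i.+2 _)) => //.
  - by move=> x y; rewrite -opprD normrN; exact: lipschitz_sector.
  - by rewrite /= !ltnS.
  - by rewrite /= ltrNr Ht // mem_nth.
near=> t.
have h1 : 0 < complex.Im (s' t)`_0 by near: t.
have h2 : - e < sector alpha (s' t)`_0 by near: t.
have h3 : `|a - (s' t)`_0| < d by near: t.
have h4 : forall i : 'I_(size t0), e < - sector alpha (s' t)`_i.+2 by near: t.
have : size (s' t) = size [:: a, (a^*)%C & t0] by rewrite -(perm_size (sp' t)) ss.
have := sE t; rewrite (perm_big _ (sp' t)) /=.
case: (s' t) h1 h2 h3 h4 => [|b [|c r]] //= h1 h2 h3 h4 fE [sr].
have Hr z : z \in r -> sector alpha z < - e.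
  move=> zr; rewrite ltrNr; have ir : (index z r < size t0)%N by rewrite -sr index_mem.
  by have := h4 (Ordinal ir); rewrite /= nth_index.
exists b, r; split=> //; split=> //.
(* The conjugate of [b] is a root. It is not [b], which is not real, nor in [r], since [sector] is
   invariant under conjugation; so it is [c]. *)
suff cE : (b^*)%C = c by rewrite fE !big_cons cE mulrA.
have : (b^*)%C \in [:: b, c & r].
  rewrite -root_prod_XsubC -fE.
  by apply: root_conjc; rewrite fE root_prod_XsubC mem_head.
rewrite !inE => /or3P[/eqP bb|/eqP //|/Hr].
  have ib : complex.Im (b^*)%C = - complex.Im b by case: (b).
  move: (congr1 (@complex.Im R) bb) h1; rewrite ib.
  by move=> ibE b0; move: (addr_gt0 b0 b0); rewrite -{1}ibE addNr ltxx.
by rewrite sector_conjc => /(lt_trans h2); rewrite ltxx.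
Unshelve. all: by end_near. Qed.

(** The factor of the pair is fixed by conjugation, and so is the real polynomial; hence so is the
    quotient. *)
Lemma rest_conjc (R : rcfType) (p : {poly R}) a (t : seq R[i]) :
  toC p = ('X - a%:P) * ('X - (a^*)%C%:P) * \prod_(z <- t) ('X - z%:P) ->
  forall z, z \in t -> (z^*)%C \in t.
Proof.
move=> pE z zt.
have conjXsub (b : R[i]) : map_poly (@conjc R) ('X - b%:P) = 'X - (b^*)%C%:P.
  by rewrite rmorphB /= map_polyX map_polyC.
have tE : \prod_(z <- t) ('X - z%:P) = map_poly (@conjc R) (\prod_(z <- t) ('X - z%:P)).
  apply: (@mulfI _ (('X - a%:P) * ('X - (a^*)%C%:P))).
    by rewrite mulf_neq0 ?polyXsubC_eq0.
  rewrite -{1}pE; have -> : toC p = map_poly (@conjc R) (toC p).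
    by apply/polyP => i; rewrite !coef_map /= oppr0.
  rewrite pE !rmorphM /= !conjXsub conjcK; congr (_ * _); exact: mulrC.
rewrite -root_prod_XsubC tE rootE horner_map.
by move: zt; rewrite -root_prod_XsubC rootE => /eqP->; rewrite rmorph0.
Qed.

(** * Minors and the side of the critical line *)

Lemma cvg_nabla (R : realType) T (F : set_system T) n (alpha : R)
    (f : T -> {poly R}) (f0 : {poly R}) p : Filter F ->
  (forall i, (fun t => (f t)`_i) @ F --> f0`_i) ->
  (fun t => nabla n alpha (f t) p) @ F --> nabla n alpha f0 p.
Proof.
move=> FF H; rewrite /nabla; apply: cvg_det => i j.
rewrite mxE (_ : (fun t => _) = (fun t => RH_entry n alpha (f t) i j)); last first.
  by apply/funext => t; rewrite mxE.
rewrite /RH_entry; case: ifP => _; first exact: cvg_cst.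
have Hh k : (fun t => hcoef n (f t) k) @ F --> hcoef n f0 k.
  by rewrite /hcoef; case: ifP => _; [exact: H|exact: cvg_cst].
by case: ifP => _; apply: cvgM (Hh _) _; exact: cvg_cst.
Qed.

Lemma cvg_coef (R : realType) T (F : set_system T) n (f : T -> {poly R})
    (f0 : {poly R}) : Filter F ->
  (forall t, f t \is monic) -> (forall t, size (f t) = n.+1) ->
  f0 \is monic -> size f0 = n.+1 ->
  (forall j, (1 <= j <= n)%N ->
     (fun t => hcoef n (f t) j) @ F --> hcoef n f0 j) ->
  forall i, (fun t => (f t)`_i) @ F --> f0`_i.
Proof.
move=> FF fm sf f0m sf0 H i; case: (ltngtP i n) => [ni|ni|->].
- have jn : (1 <= n - i <= n)%N by lia.
  have := H _ jn; rewrite /hcoef (andP jn).2.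
  by rewrite (_ : n - (n - i) = i)%N //; lia.
- have -> : (fun t => (f t)`_i) = cst 0.
    by apply/funext => t; rewrite nth_default ?sf.
  by rewrite nth_default ?sf0 //; exact: cvg_cst.
- have lead (p : {poly R}) : p \is monic -> size p = n.+1 -> p`_n = 1.
    by move=> /monicP pm sp; rewrite -pm lead_coefE sp.
  have -> : (fun t => (f t)`_n) = cst 1 by apply/funext => t; rewrite lead.
  by rewrite lead //; exact: cvg_cst.
Qed.

Lemma nabla_gt0_near (R : realType) T (F : set_system T) n (alpha : R)
    (f : T -> {poly R}) (f0 : {poly R}) : Filter F ->
  (forall i, (fun t => (f t)`_i) @ F --> f0`_i) ->
  (forall p, (1 <= p <= n - 1)%N -> 0 < nabla n alpha f0 p) ->
  \forall t \near F, forall p, (1 <= p <= n - 1)%N -> 0 < nabla n alpha (f t) p.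
Proof.
move=> FF fc H0.
have nP : \forall t \near F, forall p : 'I_n, (0 < p)%N -> 0 < nabla n alpha (f t) p.
  apply: filter_forall => p; case: (posnP p) => [->|p0]; first exact: nearW.
  have pn : (1 <= p <= n - 1)%N by have := ltn_ord p; lia.
  near=> t; move=> _; near: t.
  by apply: (cvgr_gt (nabla n alpha f0 p)); [exact: cvg_nabla|exact: H0].
apply: filterS nP => t Ht p pn.
have pn' : (p < n)%N by lia.
by apply: (Ht (Ordinal pn')); case/andP: pn.
Unshelve. all: by end_near. Qed.

Lemma critical_pair (R : realType) n (alpha : R) (f : {poly R}) :
  1 < alpha < 2 -> (2 <= n)%N -> f \is monic -> size f = n.+1 ->
  nabla n alpha f n = 0 ->
  (forall p, (1 <= p <= n - 1)%N -> 0 < nabla n alpha f p) ->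
  nabla_tilde n alpha f < 0 ->
  exists a t e, [/\ 0 < e, pair_and_rest alpha e f a t & sector alpha a = 0].
Proof.
move=> alpha12 n2 fm sf H0 H Ht.
have [s fs] : exists s : seq R[i], toC f = \prod_(z <- s) ('X - z%:P).
  have [s sE] := closed_field_poly_normal (toC f); exists s.
  rewrite {1}sE; have : toC f \is monic by rewrite map_monic.
  by move/monicP => ->; rewrite scale1r.
have [r [t [r0 st Him]]] := root_on_ray fm sf n2 fs H H0 Ht.
set w := ray alpha in st Him; set a := (r%:C)%C * w in st.
have aE : a = Complex (r * cos (alpha * pi / 2)) (r * sin (alpha * pi / 2)).
  by rewrite /a /w /ray; simpc.
have a0 : 0 < complex.Im a by rewrite aE /= mulr_gt0 // sin_theta_gt0.
have sa : sector alpha a = 0.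
  rewrite /sector aE; set c := cos _; set sn := sin _ => /=.
  have -> : (r * c) ^+ 2 + (r * sn) ^+ 2 = r ^+ 2.
    by rewrite !exprMn -mulrDr /c /sn cos2Dsin2 mulr1.
  by rewrite sqrtr_sqr ger0_norm ?ltW // subrr.
have fs' : toC f = \prod_(z <- a :: t) ('X - z%:P) by rewrite fs (perm_big _ st).
(* The conjugate of the root on the ray is a root different from [a], so it is among the others. *)
have aJt : (a^*)%C \in t.
  have : root (toC f) (a^*)%C by apply: root_conjc; rewrite fs' root_prod_XsubC mem_head.
  rewrite fs' root_prod_XsubC inE => /predU1P[aJ|//].
  by move: a0; rewrite -aJ aE /= oppr_gt0 ltNge mulr_ge0 // ltW // sin_theta_gt0.
pose t2 := rem (a^*)%C t.
have fE : toC f = ('X - a%:P) * ('X - (a^*)%C%:P) * \prod_(z <- t2) ('X - z%:P).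
  by rewrite fs' big_cons (perm_big _ (perm_to_rem aJt)) big_cons mulrA.
have t2t z : z \in t2 -> z \in t by exact: mem_rem.
(* The remaining roots come in conjugate pairs beyond the ray, so [sector_lt0] applies to each;
   finiteness gives a uniform [e]. *)
have [e e0 He] : exists2 e, 0 < e & forall z, z \in t2 -> sector alpha z < - e.
  apply: uniform_neg => z zt; apply: sector_lt0 => //; apply: Him; first exact: t2t.
  by apply: t2t; exact: rest_conjc fE _ zt.
exists a, t2, e; split=> //; split=> //.
by rewrite sa oppr_lt0.
Qed.

Lemma pair_stable (R : realType) n (alpha e : R) (f : {poly R}) a t :
  1 < alpha < 2 -> f \is monic -> size f = n.+1 ->
  pair_and_rest alpha e f a t ->
  (forall p, (0 < p <= n)%N -> 0 < nabla n alpha f p) -> stable_region alpha a.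
Proof.
move=> alpha12 fm sf H Hp; have fs := pair_roots H.
have Him := roots_right_of_ray fm sf fs Hp.
have [_ a0 _ _] := H.
apply: stableP => //; first by apply: contraTneq a0 => ->; rewrite ltxx.
by apply: sector_lt0 => //; apply: Him; rewrite !inE eqxx ?orbT.
Qed.

(** If [sector] were nonpositive at [a], it would be so at every root, and [sector_le0] would
    exclude the root found by [root_left_of_ray]. *)
Lemma pair_unstable (R : realType) n (alpha e : R) (f : {poly R}) a t :
  1 < alpha < 2 -> (1 <= n)%N -> f \is monic -> size f = n.+1 -> 0 < e ->
  pair_and_rest alpha e f a t ->
  (forall p, (1 <= p <= n - 1)%N -> 0 < nabla n alpha f p) ->
  nabla n alpha f n < 0 -> unstable_region alpha a.
Proof.
move=> alpha12 n1 fm sf e0 H Hp Hn; have fs := pair_roots H.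
have [z zs z0] := root_left_of_ray fm sf n1 fs Hp Hn.
have [_ a0 _ Ht] := H.
apply: unstableP => //; first by apply: contraTneq a0 => ->; rewrite ltxx.
rewrite ltNge; apply/negP => sa.
have : sector alpha z <= 0.
  move: zs; rewrite !inE => /or3P[/eqP -> //|/eqP ->|/Ht h]; first by rewrite sector_conjc.
  by apply: ltW (lt_trans h _); rewrite oppr_lt0.
by move/(sector_le0 alpha12); rewrite leNgt z0.
Qed.

Unset Implicit Arguments.

Theorem theorem1 (R : realType) (n m : nat) (alpha : R) (U : set 'rV[R]_m)
    (g : 'rV[R]_n -> 'rV[R]_m -> 'rV[R]_n) (xs : 'rV[R]_m -> 'rV[R]_n)
    (mus : 'rV[R]_m) (f := sys_charpoly g xs)
    (alpha12 : 1 < alpha < 2) (n2 : (2 <= n)%N)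
    (openU : open U) (Umus : U mus)
    (xs_eq : forall mu, U mu -> equilibrium g mu (xs mu))
    (g_diff : forall mu, U mu -> differentiable (fun x => g x mu) (xs mu))
    (a_cont : forall j : nat, (1 <= j <= n)%N ->
       {within U, continuous (fun mu => hcoef n (f mu) j)})
    (nabla_n0 : nabla n alpha (f mus) n = 0)
    (nabla_pos : forall p : nat, (1 <= p <= n - 1)%N ->
       0 < nabla n alpha (f mus) p)
    (tilde_neg : nabla_tilde n alpha (f mus) < 0)
    (transversality : forall V : set 'rV[R]_m, nbhs mus V -> V `<=` U ->
       exists mu1 mu2, [/\ V mu1, V mu2, 0 < nabla n alpha (f mu1) n
                         & nabla n alpha (f mu2) n < 0]) :
  hopf_bifurcation alpha U g xs mus.
Proof.
have fm mu : f mu \is monic by exact: char_poly_monic.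
have sf mu : size (f mu) = n.+1 by exact: size_char_poly.
rewrite /hopf_bifurcation -/f; clearbody f.
have fc mu0 : U mu0 -> forall i, (fun mu => (f mu)`_i) @ mu0 --> (f mu0)`_i.
  move=> Umu0; apply: (cvg_coef (nbhs_filter mu0) fm sf (fm _) (sf _)) => j jn.
  have := a_cont _ jn; rewrite continuous_open_subspace //.
  by move/(_ mu0 (mem_set Umu0)).
have [a [t [e [e0 Ha sa]]]] := critical_pair alpha12 n2 (fm _) (sf _) nabla_n0
  nabla_pos tilde_neg.
(* On [U0] the lower minors stay positive, so the sign of the last one locates the pair. *)
pose U0 : set 'rV[R]_m := [set mu | [/\ U mu,
  forall p, (1 <= p <= n - 1)%N -> 0 < nabla n alpha (f mu) p
  & exists b r, pair_and_rest alpha e (f mu) b r]].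
pose S mu : set R[i] := [set b | exists r, pair_and_rest alpha e (f mu) b r].
(* The default 0 is taken only where no such root exists, hence off [U0]; [pair_unique] makes the
   choice canonical. *)
pose lam mu : R[i] := xget 0 (S mu).
have lamS mu b r : pair_and_rest alpha e (f mu) b r -> S mu (lam mu).
  by move=> Hb; apply: (xgetPex 0); exists b, r.
have lamP mu : U0 mu -> exists r, pair_and_rest alpha e (f mu) (lam mu) r.
  by case=> _ _ [b [r Hb]]; exact: lamS Hb.
have lam_uniq mu b r : pair_and_rest alpha e (f mu) b r -> lam mu = b.
  move=> Hb; have [q Hq] := lamS _ _ _ Hb.
  have [_ l0 le _] := Hq; apply: (pair_unique Hb _ l0 le).
  by rewrite (pair_roots Hq) root_prod_XsubC mem_head.
have U0mus : nbhs mus U0.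
  have nU : \forall mu \near mus, U mu by exact: open_nbhs_nbhs.
  have nP := nabla_gt0_near (nbhs_filter mus) (fc _ Umus) nabla_pos.
  have nS := @pair_near _ alpha e n.+1 _ (nbhs mus) f _ _ _ (nbhs_filter mus) fm sf (sf mus) (fc _ Umus) Ha 1 ltr01.
  near=> mu; split.
  - by near: mu.
  - move=> p pn; have pn' : (p < n)%N by lia.
    by move: p pn {pn'}; near: mu.
  - have : exists b r, pair_and_rest alpha e (f mu) b r /\ `|a - b| < 1 by near: mu.
    by case=> b [r [Hb _]]; exists b, r.
have lam_mus : lam mus = a by exact: lam_uniq Ha.
exists U0, lam; split.
- by split=> // mu [].
- apply/subspace_continuousP => mu U0mu; have [r Hr] := lamP _ U0mu.
  have [Umu _ _] := U0mu.
  apply/cvgrPdist_lt => d d0; rewrite near_withinE.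
  (* [pair_near] yields some pair close to [lam mu]; by uniqueness it is the one chosen at [nu]. *)
  have nS := @pair_near _ alpha e n.+1 _ (nbhs mu) f _ _ _ (nbhs_filter mu) fm sf (sf mu) (fc _ Umu) Hr d d0.
  near=> nu; move=> _.
  have [b [q [Hb bd]]] : exists b r, pair_and_rest alpha e (f nu) b r
      /\ `|lam mu - b| < d by near: nu.
  by move: bd; rewrite -(lam_uniq _ _ _ Hb).
- move=> mu U0mu; have [r Hr] := lamP _ U0mu; have [fE l0 _ Hlt] := Hr; split.
    by case: (lam mu) l0 => x y /= y0; rewrite complex_real gt_eqF.
  have sr : size r == (n - 2)%N.
    have := size_map_poly (real_complex R) (f mu).
    by rewrite (pair_roots Hr) size_prod_XsubC sf /= => -[<-]; rewrite subn2.
  exists (Tuple sr); first exact: fE.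
  move=> z /= zr; have zs := Hlt _ zr; have zneg : sector alpha z < 0 by lra.
  apply: stableP => //; apply: contraTneq zneg => ->.
  by rewrite /sector /= expr0n addr0 sqrtr0 mul0r subrr ltxx.
- have [_ a0 _ _] := Ha; rewrite lam_mus; apply: criticalP => //.
  by apply: contraTneq a0 => ->; rewrite ltxx.
(* Transversality is applied inside [V] and [U0] at once, where the lower minors are positive. *)
move=> V nV; have nW : nbhs mus (V `&` U0) by exact: filterI.
have [|mu1 [mu2 [W1 W2 pos1 neg2]]] := transversality _ nW.
  by move=> mu [_ []].
split.
  exists mu1 => //; have [_ U1] := W1; have [r Hr] := lamP _ U1; have [_ P1 _] := U1.
  apply: (pair_stable alpha12 (fm _) (sf _) Hr) => p /andP[p0 pn].
  by case: (ltngtP p n) pn => // [pn _|-> //]; apply: P1; lia.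
exists mu2 => //; have [_ U2] := W2; have [r Hr] := lamP _ U2; have [_ P2 _] := U2.
apply: (pair_unstable alpha12 _ (fm _) (sf _) e0 Hr P2 neg2); lia.
Unshelve. all: by end_near. Qed.
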